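(* Let $a<b$ be real numbers and let $G_1,\ldots,G_r$ be complex functions holomorphic on the strip $\mathrm{Re}(s)\in[a,b]$, with $\overline{G_i(s)}=G_i(\overline{s})$ and $C_1\exp\left(-C_2e^{C_3|t|}\right)<|G_i(\sigma+it)|$ for all $\sigma\in[a,b]$ and real $t$, for some $C_1,C_2>0$ and $0<C_3<\frac{\pi}{b-a}$. Let $f$ be holomorphic on the strip with $|f(\sigma+it)|<C_1\exp\left(C_2e^{C_3|t|}\right)$ for all $\sigma\in[a,b]$ and real $t$. Let $\alpha_1,\ldots,\alpha_r\ge0$ and $\beta_1,\ldots,\beta_r\ge0$ be real numbers such that for all real $t$ \[ |f(a+it)|\le\prod_{i=1}^r|G_i(a+it)|^{\alpha_i}\quad\text{and}\quad |f(b+it)|\le\prod_{i=1}^r|G_i(b+it)|^{\beta_i}. \] Let $T_0\ge0$ and suppose that for every $t$ with $|t|>T_0$, the function $\sigma\mapsto|G_i(\sigma+it)|$ on $[a,b]$ is increasing if $\alpha_i>\beta_i$ and decreasing if $\beta_i>\alpha_i$. Finally suppose that for every $t$ with $|t|\le T_0$ and every $\sigma\in[a,b]$, \[ |f(\sigma+it)| < \prod_{i=1}^r\left(\min_{\sigma'\in[a,b]}|G_i(\sigma'+it)|\right)^{\alpha_i\frac{b-\sigma}{b-a}+\beta_i\frac{\sigma-a}{b-a}}. \] Then for all $a\le\sigma\le b$ and all real $t$, \[ |f(\sigma+it)|\le\left(\prod_{i=1}^r|G_i(\sigma+it)|^{\alpha_i}\right)^{\frac{b-\sigma}{b-a}}\left(\prod_{i=1}^r|G_i(\sigma+it)|^{\beta_i}\right)^{\frac{\sigma-a}{b-a}}.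 \] *)

(* Defs.v *)
From Stdlib Require Import Reals List ClassicalEpsilon.
From Coquelicot Require Import Coquelicot.

Open Scope R_scope.

(* The point sigma + it of Coquelicot's C (= R * R) is the pair (sigma, t). *)

Definition strip (a b : R) (s : C) : Prop := a <= Re s <= b.

(* The strip is closed, so "holomorphic on the strip" means complex
   differentiable at every point of some open set containing it.  Since
   f : C -> C, ex_derive is taken here over the field C_AbsRing, i.e. it is
   complex differentiability. *)
Definition holomorphic_on (S : C -> Prop) (f : C -> C) : Prop :=
  exists U : C -> Prop,
    open U /\ (forall s : C, S s -> U s) /\ (forall s : C, U s -> ex_derive f s).

(* Monotonicity is in the wide sense; strictly monotone functions qualify. *)
Definition increasing_on (a b : R) (g : R -> R) : Prop :=
  forall x y : R, a <= x -> x <= y -> y <= b -> g x <= g y.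

Definition decreasing_on (a b : R) (g : R -> R) : Prop :=
  forall x y : R, a <= x -> x <= y -> y <= b -> g y <= g x.

Definition is_min_on (a b : R) (g : R -> R) (m : R) : Prop :=
  (exists x : R, a <= x <= b /\ g x = m) /\
  (forall x : R, a <= x <= b -> m <= g x).

(* Unspecified when g has no minimum on [a, b]; it has one, by compactness,
   when g is continuous there and a <= b. *)
Definition min_on (a b : R) (g : R -> R) : R :=
  epsilon (inhabits 0) (is_min_on a b g).

(* The product F 0 * ... * F (r - 1). *)
Definition Rprod (r : nat) (F : nat -> R) : R :=
  fold_right Rmult 1 (map F (seq 0 r)).

(* Main.v *)
(* Let psi be ln |f| minus the logarithm of the right-hand side, minus
   eps Re cos (c (s - (a + b) / 2)) with C3 < c < PI / (b - a), plus eps (sigma - a) (sigma - b).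
   It tends to - oo at both ends of the strip.  If psi > 0 somewhere, its maximum p is an interior
   point with |t| > T0.  In the sum of psi over p + (x, y) and p + (- x, y) the variation of the
   interpolated exponents has a favourable sign, by the monotonicity of |G_i|.  What remains is, up
   to third order, the real part of a holomorphic function whose reflected sums at distance rho
   from p are at most - eps rho^2.  This contradicts the mean value property, which is Goursat's
   theorem for k (exp w) on rectangles of height 2 PI. *)
Require Import Defs.
From Stdlib Require Import Reals List ClassicalEpsilon Classical Lra Lia.
From Coquelicot Require Import Coquelicot.

Open Scope R_scope.

(** For |t| > T0 the logarithm of the right-hand side is superharmonic: a product of an exponent
    affine in sigma and the harmonic ln |G_i| has Laplacian 2 (beta_i - alpha_i) / (b - a) times the
    sigma-derivative of ln |G_i|, which is at most 0 by monotonicity. Reflected sums express this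
    without second derivatives. An affine exponent deviates by opposite amounts at p + (x, y) and p
    + (- x, y); these points share the height t + y, where monotonicity compares the two values of
    |G_i|; circles around p are invariant under the reflection, so the mean value property survives
    it. The two corrections have separate tasks. The cosine has real part cos (c (sigma - (a + b) /
    2)) cosh (c t): c < PI / (b - a) keeps it positive on the closed strip, and c > C3 lets it
    outgrow the bounds on f and the G_i. Being harmonic, it gives no strictness; (sigma - a) (sigma
    - b), strictly convex in sigma and at most 0 on the strip, supplies it. A small eps at a fixed
    point then gives the claim. *)

(** * Bisection of rectangles and attained maxima *)

(** If [P] failed, some quarter would fail again and again; the nested failing rectangles shrink to
    a point, where the local hypothesis is violated. This one argument serves both for compactness
    and for Goursat's theorem. *)
Lemma rectangle_bisection (P : R -> R -> R -> R -> Prop) (x0 x1 y0 y1 : R) :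
  x0 <= x1 -> y0 <= y1 ->
  (forall u v c d : R, x0 <= u -> u <= v -> v <= x1 -> y0 <= c -> c <= d -> d <= y1 ->
    P u ((u + v) / 2) c ((c + d) / 2) -> P ((u + v) / 2) v c ((c + d) / 2) ->
    P u ((u + v) / 2) ((c + d) / 2) d -> P ((u + v) / 2) v ((c + d) / 2) d ->
    P u v c d) ->
  (forall x y : R, x0 <= x <= x1 -> y0 <= y <= y1 ->
    exists delta : R, 0 < delta /\ forall u v c d : R,
      x0 <= u <= x -> x <= v <= x1 -> y0 <= c <= y -> y <= d <= y1 ->
      v - u < delta -> d - c < delta -> P u v c d) ->
  P x0 x1 y0 y1.
Proof.
  intros hx hy hsplit hloc.
  apply NNPP; intro hbad.
  set (bad := fun q : (R * R) * (R * R) =>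
    let '((u, v), (c, d)) := q in
    x0 <= u /\ u <= v /\ v <= x1 /\ y0 <= c /\ c <= d /\ d <= y1 /\ ~ P u v c d).
  set (half := fun q q' : (R * R) * (R * R) =>
    let '((u, v), (c, d)) := q in let '((u', v'), (c', d')) := q' in
    u <= u' /\ v' <= v /\ c <= c' /\ d' <= d /\
    v' - u' = (v - u) / 2 /\ d' - c' = (d - c) / 2).
  assert (hnext : forall q, bad q -> exists q', bad q' /\ half q q').
  { intros [[u v] [c d]] (h1 & h2 & h3 & h4 & h5 & h6 & hP).
    apply NNPP; intro hno.
    assert (hq : forall u' v' c' d', half ((u, v), (c, d)) ((u', v'), (c', d')) ->
      P u' v' c' d').
    { intros u' v' c' d' hh. apply NNPP; intro hP'. apply hno.
      exists ((u', v'), (c', d')); split; [|exact hh].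
      unfold half in hh; unfold bad. repeat split; try lra. exact hP'. }
    apply hP, hsplit; try assumption; apply hq; unfold half; repeat split; lra. }
  (* The proof of badness travels with the rectangle, so that a bad half-size successor can be
     chosen at every step. *)
  set (nxt := fun q : {q | bad q} =>
    let s := constructive_indefinite_description _ (hnext (proj1_sig q) (proj2_sig q)) in
    exist bad (proj1_sig s) (proj1 (proj2_sig s))).
  assert (bad0 : bad ((x0, x1), (y0, y1))).
  { unfold bad; repeat split; try lra; exact hbad. }
  set (sq := fix sq n : {q | bad q} :=
    match n with O => exist bad _ bad0 | S n => nxt (sq n) end).
  set (lx := fun n => fst (fst (proj1_sig (sq n)))).
  set (rx := fun n => snd (fst (proj1_sig (sq n)))).
  set (ly := fun n => fst (snd (proj1_sig (sq n)))).
  set (ry := fun n => snd (snd (proj1_sig (sq n)))).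
  assert (hb : forall n, x0 <= lx n /\ lx n <= rx n /\ rx n <= x1 /\
     y0 <= ly n /\ ly n <= ry n /\ ry n <= y1 /\ ~ P (lx n) (rx n) (ly n) (ry n)).
  { intro n. unfold lx, rx, ly, ry. destruct (sq n) as [[[u v] [c d]] hq]; exact hq. }
  assert (hh : forall n, lx n <= lx (S n) /\ rx (S n) <= rx n /\ ly n <= ly (S n) /\
     ry (S n) <= ry n /\ rx (S n) - lx (S n) = (rx n - lx n) / 2 /\
     ry (S n) - ly (S n) = (ry n - ly n) / 2).
  { intro n. unfold lx, rx, ly, ry. simpl sq. unfold nxt.
    destruct (constructive_indefinite_description _ _) as [q' [hq' hhalf]]; simpl.
    destruct (sq n) as [[[u v] [c d]] hq]; destruct q' as [[u' v'] [c' d']]; exact hhalf. }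
  assert (lim : forall l r : nat -> R,
     (forall n, l n <= r n) -> (forall n, l n <= l (S n)) -> (forall n, r (S n) <= r n) ->
     exists z, forall n, l n <= z <= r n).
  { intros l r hlr hl hr.
    assert (hlm : forall n m, (n <= m)%nat -> l n <= l m).
    { intros n m hnm; induction hnm; [lra | specialize (hl m); lra]. }
    assert (hrm : forall n m, (n <= m)%nat -> r m <= r n).
    { intros n m hnm; induction hnm; [lra | specialize (hr m); lra]. }
    assert (hub : forall n m, l n <= r m).
    { intros n m. specialize (hlr (Nat.max n m)).
      specialize (hlm n (Nat.max n m) ltac:(lia)).
      specialize (hrm m (Nat.max n m) ltac:(lia)). lra. }
    destruct (completeness (fun z => exists n, z = l n)) as [z [hz1 hz2]].
    - exists (r O); intros z [n ->]; apply hub.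
    - exists (l O), O; reflexivity.
    - exists z; intro n; split.
      + apply hz1; exists n; reflexivity.
      + apply hz2; intros w [m ->]; apply hub. }
  destruct (lim lx rx) as [x hxn]; try (intro n; apply hb || apply hh).
  destruct (lim ly ry) as [y hyn]; try (intro n; apply hb || apply hh).
  assert (hsz : forall n, rx n - lx n = (x1 - x0) * (/ 2) ^ n /\
                          ry n - ly n = (y1 - y0) * (/ 2) ^ n).
  { induction n as [|n [IH1 IH2]].
    - unfold lx, rx, ly, ry; simpl; lra.
    - destruct (hh n) as (_ & _ & _ & _ & e1 & e2). rewrite e1, e2, IH1, IH2. simpl; lra. }
  destruct (hloc x y) as [delta [hd hP]].
  { specialize (hxn O); unfold lx, rx in hxn; simpl in hxn; lra. }
  { specialize (hyn O); unfold ly, ry in hyn; simpl in hyn; lra. }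
  (* Both side lengths at stage [N] are at most their initial sum times 2^-N; the added 1 keeps the
     quotient defined for a degenerate rectangle. *)
  destruct (pow_lt_1_zero (/ 2)) with (y := delta / (x1 - x0 + (y1 - y0) + 1)) as [N hN].
  { rewrite Rabs_pos_eq; lra. }
  { apply Rdiv_lt_0_compat; lra. }
  specialize (hN N (Nat.le_refl _)).
  assert (hp : 0 < (/ 2) ^ N) by (apply pow_lt; lra).
  rewrite Rabs_pos_eq in hN by lra.
  apply Rmult_lt_compat_r with (r := x1 - x0 + (y1 - y0) + 1) in hN; [|lra].
  unfold Rdiv in hN; rewrite Rmult_assoc, Rinv_l, Rmult_1_r in hN by lra.
  destruct (hsz N) as [e1 e2]. specialize (hxn N). specialize (hyn N).
  destruct (hb N) as (b1 & b2 & b3 & b4 & b5 & b6 & b7).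
  apply b7, hP; try lra; nra.
Qed.

(** The bisected property is that a single point of the whole rectangle dominates [F] on the
    subrectangle. Letting the dominating point lie outside the subrectangle makes the property easy
    to merge: the best of four such points dominates all four quarters. The continuity hypothesis is
    upper semicontinuity. *)
Lemma rectangle_max (F : R -> R -> R) (x0 x1 y0 y1 : R) :
  x0 <= x1 -> y0 <= y1 ->
  (forall x y : R, x0 <= x <= x1 -> y0 <= y <= y1 ->
    forall eps : R, 0 < eps -> exists delta : R, 0 < delta /\
      forall x' y' : R, Rabs (x' - x) < delta -> Rabs (y' - y) < delta ->
        F x' y' < F x y + eps) ->
  exists x y : R, x0 <= x <= x1 /\ y0 <= y <= y1 /\
    forall x' y' : R, x0 <= x' <= x1 -> y0 <= y' <= y1 -> F x' y' <= F x y.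
Proof.
  intros hx hy hc.
  apply (rectangle_bisection (fun u v c d => exists x y, x0 <= x <= x1 /\ y0 <= y <= y1 /\
    forall x' y', u <= x' <= v -> c <= y' <= d -> F x' y' <= F x y)); try assumption.
  - intros u v c d _ _ _ _ _ _.
    intros (p1 & q1 & hp1 & hq1 & h1) (p2 & q2 & hp2 & hq2 & h2)
      (p3 & q3 & hp3 & hq3 & h3) (p4 & q4 & hp4 & hq4 & h4).
    assert (best : exists p q, x0 <= p <= x1 /\ y0 <= q <= y1 /\
      F p1 q1 <= F p q /\ F p2 q2 <= F p q /\ F p3 q3 <= F p q /\ F p4 q4 <= F p q).
    { destruct (Rle_dec (F p1 q1) (F p2 q2)); destruct (Rle_dec (F p3 q3) (F p4 q4));
      [destruct (Rle_dec (F p2 q2) (F p4 q4)); [exists p4, q4 | exists p2, q2]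
      |destruct (Rle_dec (F p2 q2) (F p3 q3)); [exists p3, q3 | exists p2, q2]
      |destruct (Rle_dec (F p1 q1) (F p4 q4)); [exists p4, q4 | exists p1, q1]
      |destruct (Rle_dec (F p1 q1) (F p3 q3)); [exists p3, q3 | exists p1, q1]];
      repeat split; lra. }
    destruct best as (p & q & hp & hq & e1 & e2 & e3 & e4).
    exists p, q; repeat split; try lra. intros x' y' hx' hy'.
    destruct (Rle_dec x' ((u + v) / 2)); destruct (Rle_dec y' ((c + d) / 2));
      [specialize (h1 x' y') | specialize (h3 x' y') | specialize (h2 x' y')
      |specialize (h4 x' y')]; lra.
  - intros x y hx' hy'.
    (* Either some point beats [F x y], and then by semicontinuity it dominates near (x, y), or (x,
       y) is itself a maximum. *)
    destruct (classic (exists p q, x0 <= p <= x1 /\ y0 <= q <= y1 /\ F x y < F p q))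
      as [(p & q & hp & hq & hlt) | hno].
    + destruct (hc x y hx' hy' (F p q - F x y)) as [delta [hd h]]; [lra|].
      exists delta; split; [exact hd|].
      intros u v c d hu hv hcc hdd s1 s2. exists p, q; repeat split; try lra.
      intros x' y' i1 i2. left.
      replace (F p q) with (F x y + (F p q - F x y)) by ring.
      apply h; apply Rabs_def1; lra.
    + exists 1; split; [lra|].
      intros u v c d hu hv hcc hdd _ _. exists x, y; repeat split; try lra.
      intros x' y' i1 i2. apply Rnot_lt_le; intro hlt. apply hno.
      exists x', y'; repeat split; lra.
Qed.

(** * Goursat's theorem for closed forms on rectangles *)

Lemma RInt_affine (p q u v : R) :
  RInt (fun s => p + q * s) u v = p * (v - u) + q * (v * v - u * u) / 2.
Proof.
  apply is_RInt_unique.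
  replace (p * (v - u) + q * (v * v - u * u) / 2) with
    (minus (p * v + q * (v * v) / 2) (p * u + q * (u * u) / 2))
    by (unfold minus, plus, opp; simpl; field).
  apply (is_RInt_derive (fun s => p * s + q * (s * s) / 2)).
  - intros s _. auto_derive; [exact I | field].
  - intros s _. apply (ex_derive_continuous (fun s => p + q * s)). auto_derive; exact I.
Qed.

(* The integral of V dx + U dy along the boundary of [u, v] x [c, d]. *)
Definition boundary_int (U V : R -> R -> R) (u v c d : R) : R :=
  RInt (fun x => V x c) u v - RInt (fun x => V x d) u v
  + RInt (fun y => U v y) c d - RInt (fun y => U u y) c d.

Lemma boundary_int_quarter (U V : R -> R -> R) (u v c d m n : R) :
  u <= m <= v -> c <= n <= d ->
  (forall x y, u <= x <= v -> c <= y <= d ->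
    continuous (fun s => V s y) x /\ continuous (fun s => U x s) y) ->
  boundary_int U V u v c d =
  boundary_int U V u m c n + boundary_int U V m v c n +
  boundary_int U V u m n d + boundary_int U V m v n d.
Proof.
  intros hm hn hc.
  assert (iV : forall y u' v', c <= y <= d -> u <= u' <= v' -> v' <= v ->
    ex_RInt (fun x => V x y) u' v').
  { intros y u' v' h1 h2 h3; apply (ex_RInt_continuous (fun x => V x y)).
    intros x hx; rewrite Rmin_left, Rmax_right in hx by lra. apply hc; lra. }
  assert (iU : forall x u' v', u <= x <= v -> c <= u' <= v' -> v' <= d ->
    ex_RInt (fun y => U x y) u' v').
  { intros x u' v' h1 h2 h3; apply (ex_RInt_continuous (fun y => U x y)).
    intros y hy; rewrite Rmin_left, Rmax_right in hy by lra. apply hc; lra. }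
  unfold boundary_int.
  assert (eV : forall y, c <= y <= d -> RInt (fun x => V x y) u v =
    RInt (fun x => V x y) u m + RInt (fun x => V x y) m v)
    by (intros y hy; symmetry; apply (RInt_Chasles (fun x => V x y)); apply iV; lra).
  assert (eU : forall x, u <= x <= v -> RInt (fun y => U x y) c d =
    RInt (fun y => U x y) c n + RInt (fun y => U x y) n d)
    by (intros x hx; symmetry; apply (RInt_Chasles (fun y => U x y)); apply iU; lra).
  rewrite (eV c), (eV d), (eU u), (eU v) by lra. ring.
Qed.

(** In Goursat's estimate each side is compared with the affine model at the limit point;
    integrating the model exactly lets the four models cancel and leaves only the errors. *)
Lemma RInt_near_affine (g : R -> R) (p q e u v : R) :
  u <= v -> (forall s, u <= s <= v -> continuous g s) ->
  (forall s, u <= s <= v -> Rabs (g s - (p + q * s)) <= e) ->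
  Rabs (RInt g u v - (p * (v - u) + q * (v * v - u * u) / 2)) <= (v - u) * e.
Proof.
  intros huv hg h.
  assert (ig : ex_RInt g u v) by (apply (ex_RInt_continuous g);
      intros s hs; rewrite Rmin_left, Rmax_right in hs by lra;
      apply hg, hs).
  assert (cl : forall s, continuous (fun s => p + q * s) s)
    by (intro s; apply (ex_derive_continuous (fun s => p + q * s)); auto_derive; exact I).
  assert (il : ex_RInt (fun s => p + q * s) u v)
    by (apply (ex_RInt_continuous (fun s => p + q * s)); intros; apply cl).
  rewrite <- RInt_affine.
  change (Rabs (minus (RInt g u v) (RInt (fun s => p + q * s) u v)) <= (v - u) * e).
  rewrite <- (RInt_minus g _ u v ig il).
  apply abs_RInt_le_const; [exact huv | apply (ex_RInt_minus g); assumption | exact h].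
Qed.

(* Goursat's argument: no continuity of the partial derivatives is assumed. *)
Lemma boundary_int_closed_form (U V : R -> R -> R) (x0 x1 y0 y1 : R) :
  x0 <= x1 -> y0 <= y1 ->
  (forall x y, x0 <= x <= x1 -> y0 <= y <= y1 ->
    continuous (fun s => V s y) x /\ continuous (fun s => U x s) y) ->
  (forall x y, x0 <= x <= x1 -> y0 <= y <= y1 ->
    exists u1 u2 v1 : R, forall eps : R, 0 < eps -> exists delta : R, 0 < delta /\
      forall x' y' : R, Rabs (x' - x) < delta -> Rabs (y' - y) < delta ->
        Rabs (U x' y' - (U x y + u1 * (x' - x) + u2 * (y' - y))) <=
          eps * (Rabs (x' - x) + Rabs (y' - y)) /\
        Rabs (V x' y' - (V x y + v1 * (x' - x) + u1 * (y' - y))) <=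
          eps * (Rabs (x' - x) + Rabs (y' - y))) ->
  boundary_int U V x0 x1 y0 y1 = 0.
Proof.
  intros hx hy hc hd.
  (* The square of the half-perimeter is exactly additive under quartering: four quarters contribute
     4 (l / 2)^2 = l^2. *)
  assert (bound : forall eps, 0 < eps ->
    Rabs (boundary_int U V x0 x1 y0 y1) <= eps * (2 * (x1 - x0 + (y1 - y0)) ^ 2)).
  { intros eps heps.
    apply (rectangle_bisection (fun u v c d =>
      Rabs (boundary_int U V u v c d) <= eps * (2 * (v - u + (d - c)) ^ 2))); try assumption.
    - intros u v c d i1 i2 i3 i4 i5 i6 h1 h2 h3 h4.
      rewrite (boundary_int_quarter U V u v c d ((u + v) / 2) ((c + d) / 2));
        [|lra|lra|intros x y ? ?; apply hc; lra].
      pose proof (Rabs_triang (boundary_int U V u ((u + v) / 2) c ((c + d) / 2) +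
        boundary_int U V ((u + v) / 2) v c ((c + d) / 2) +
        boundary_int U V u ((u + v) / 2) ((c + d) / 2) d)
        (boundary_int U V ((u + v) / 2) v ((c + d) / 2) d)).
      pose proof (Rabs_triang (boundary_int U V u ((u + v) / 2) c ((c + d) / 2) +
        boundary_int U V ((u + v) / 2) v c ((c + d) / 2))
        (boundary_int U V u ((u + v) / 2) ((c + d) / 2) d)).
      pose proof (Rabs_triang (boundary_int U V u ((u + v) / 2) c ((c + d) / 2))
        (boundary_int U V ((u + v) / 2) v c ((c + d) / 2))).
      nra.
    - intros x y hxx hyy. destruct (hd x y hxx hyy) as (u1 & u2 & v1 & hdd).
      destruct (hdd eps heps) as (delta & hdel & h).
      exists delta; split; [exact hdel|].
      intros u v c d hu hv hcc hdr s1 s2.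
      set (e := eps * (v - u + (d - c))).
      assert (near : forall x' y', u <= x' <= v -> c <= y' <= d ->
        Rabs (U x' y' - (U x y + u1 * (x' - x) + u2 * (y' - y))) <= e /\
        Rabs (V x' y' - (V x y + v1 * (x' - x) + u1 * (y' - y))) <= e).
      { intros x' y' i1 i2.
        assert (a1 : Rabs (x' - x) <= v - u) by (apply Rabs_le; lra).
        assert (a2 : Rabs (y' - y) <= d - c) by (apply Rabs_le; lra).
        destruct (h x' y') as [g1 g2]; try lra.
        assert (eps * (Rabs (x' - x) + Rabs (y' - y)) <= e)
          by (apply Rmult_le_compat_l; lra).
        lra. }
      assert (A1 := RInt_near_affine (fun x => V x c)
        (V x y + u1 * (c - y) - v1 * x) v1 e u v ltac:(lra)
        (fun s hs => proj1 (hc s c ltac:(lra) ltac:(lra)))).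
      assert (A2 := RInt_near_affine (fun x => V x d)
        (V x y + u1 * (d - y) - v1 * x) v1 e u v ltac:(lra)
        (fun s hs => proj1 (hc s d ltac:(lra) ltac:(lra)))).
      assert (A3 := RInt_near_affine (fun y => U v y)
        (U x y + u1 * (v - x) - u2 * y) u2 e c d ltac:(lra)
        (fun s hs => proj2 (hc v s ltac:(lra) ltac:(lra)))).
      assert (A4 := RInt_near_affine (fun y => U u y)
        (U x y + u1 * (u - x) - u2 * y) u2 e c d ltac:(lra)
        (fun s hs => proj2 (hc u s ltac:(lra) ltac:(lra)))).
      assert (B1 : forall k l m : R, k = l -> Rabs k <= m -> Rabs l <= m) by (intros; subst; assumption).
      lapply A1; [clear A1; intro A1 |
        intros s hs; eapply B1; [|apply (proj2 (near s c ltac:(lra) ltac:(lra)))]; ring].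
      lapply A2; [clear A2; intro A2 |
        intros s hs; eapply B1; [|apply (proj2 (near s d ltac:(lra) ltac:(lra)))]; ring].
      lapply A3; [clear A3; intro A3 |
        intros s hs; eapply B1; [|apply (proj1 (near v s ltac:(lra) ltac:(lra)))]; ring].
      lapply A4; [clear A4; intro A4 |
        intros s hs; eapply B1; [|apply (proj1 (near u s ltac:(lra) ltac:(lra)))]; ring].
      apply Rabs_le_between in A1; apply Rabs_le_between in A2;
      apply Rabs_le_between in A3; apply Rabs_le_between in A4.
      (* The affine models cancel around the boundary because [u1] is both the x-slope of [U] and
         the y-slope of [V]. The four errors add up to 2 (v - u) e + 2 (d - c) e. *)
      unfold boundary_int. apply Rabs_le.
      replace (eps * (2 * (v - u + (d - c)) ^ 2)) with (2 * (v - u) * e + 2 * (d - c) * e)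
        by (unfold e; ring).
      nra. }
  apply NNPP; intro hne.
  assert (hpos : 0 < Rabs (boundary_int U V x0 x1 y0 y1)) by (apply Rabs_pos_lt; exact hne).
  set (M := 2 * (x1 - x0 + (y1 - y0)) ^ 2) in *.
  assert (hM : 0 <= M) by (unfold M; nra).
  specialize (bound (Rabs (boundary_int U V x0 x1 y0 y1) / (M + 1))
    ltac:(apply Rdiv_lt_0_compat; lra)).
  assert (Rabs (boundary_int U V x0 x1 y0 y1) / (M + 1) * M <
    Rabs (boundary_int U V x0 x1 y0 y1)).
  { replace (Rabs (boundary_int U V x0 x1 y0 y1)) with
      (Rabs (boundary_int U V x0 x1 y0 y1) / (M + 1) * (M + 1)) at 2 by (field; lra).
    apply Rmult_lt_compat_l; [apply Rdiv_lt_0_compat; lra | lra]. }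
  lra.
Qed.

(** * Continuity and complex differentiability in terms of the modulus *)

Lemma Cmod_le_abs (z : C) : Cmod z <= Rabs (Re z) + Rabs (Im z).
Proof.
  destruct z as [x y]; simpl.
  replace (x, y) with (RtoC x + Ci * RtoC y)%C
    by (apply injective_projections; simpl; ring).
  eapply Rle_trans; [apply Cmod_triangle|].
  rewrite Cmod_mult, Cmod_Ci, !Cmod_R. lra.
Qed.

Lemma im_le_Cmod (z : C) : Rabs (Im z) <= Cmod z.
Proof.
  eapply Rle_trans; [|apply Rmax_Cmod]. apply Rmax_r.
Qed.

(** Stated with [Cmod], so that estimates use its triangle inequality and multiplicativity. The
    uniform structure on pairs has squares as balls; [ccont_continuous] passes to it. *)
Definition ccont (g : C -> C) (p : C) : Prop :=
  forall eps : R, 0 < eps -> exists delta : R, 0 < delta /\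
    forall w : C, Cmod (w - p) < delta -> Cmod (g w - g p) < eps.

(* Caratheodory's form of complex differentiability; the derivative is q p. *)
Definition cdiff (g : C -> C) (p : C) : Prop :=
  exists q : C -> C, ccont q p /\ forall w : C, g w = (g p + q w * (w - p))%C.

Lemma ccont_const (c p : C) : ccont (fun _ => c) p.
Proof.
  intros eps he; exists 1; split; [lra|]. intros w _.
  replace (c - c)%C with (RtoC 0) by ring. rewrite Cmod_0; exact he.
Qed.

Lemma ccont_plus (g h : C -> C) (p : C) :
  ccont g p -> ccont h p -> ccont (fun w => g w + h w)%C p.
Proof.
  intros hg hh eps he.
  destruct (hg (eps / 2)) as (d1 & p1 & h1); [lra|].
  destruct (hh (eps / 2)) as (d2 & p2 & h2); [lra|].
  exists (Rmin d1 d2); split; [apply Rmin_pos; assumption|].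
  intros w hw.
  specialize (h1 w (Rlt_le_trans _ _ _ hw (Rmin_l _ _))).
  specialize (h2 w (Rlt_le_trans _ _ _ hw (Rmin_r _ _))).
  replace (g w + h w - (g p + h p))%C with ((g w - g p) + (h w - h p))%C by ring.
  pose proof (Cmod_triangle (g w - g p) (h w - h p)). lra.
Qed.

Lemma ccont_mult (g h : C -> C) (p : C) :
  ccont g p -> ccont h p -> ccont (fun w => g w * h w)%C p.
Proof.
  intros hg hh eps he.
  set (M := Cmod (g p) + Cmod (h p) + 1).
  (* With both errors below e <= 1, the product of the errors is at most e, so the total is at most
     e M <= eps / 2. *)
  pose proof (Cmod_ge_0 (g p)); pose proof (Cmod_ge_0 (h p)).
  assert (hM : 1 <= M) by (unfold M; lra).
  set (e := Rmin 1 (eps / (2 * M))).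
  assert (he' : 0 < eps / (2 * M)) by (apply Rdiv_lt_0_compat; lra).
  assert (e0 : 0 < e) by (apply Rmin_pos; lra).
  assert (e1 : e <= 1) by apply Rmin_l.
  assert (e2 : e * (2 * M) <= eps).
  { apply Rle_trans with (eps / (2 * M) * (2 * M)).
    - apply Rmult_le_compat_r; [lra | apply Rmin_r].
    - right; field; lra. }
  destruct (hg e e0) as (d1 & p1 & h1).
  destruct (hh e e0) as (d2 & p2 & h2).
  exists (Rmin d1 d2); split; [apply Rmin_pos; assumption|].
  intros w hw.
  specialize (h1 w (Rlt_le_trans _ _ _ hw (Rmin_l _ _))).
  specialize (h2 w (Rlt_le_trans _ _ _ hw (Rmin_r _ _))).
  replace (g w * h w - g p * h p)%C with
    ((g w - g p) * (h w - h p) + (g p * (h w - h p) + (g w - g p) * h p))%C by ring.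
  eapply Rle_lt_trans; [apply Cmod_triangle|].
  pose proof (Cmod_triangle (g p * (h w - h p)) ((g w - g p) * h p)) as T.
  rewrite !Cmod_mult in *.
  pose proof (Cmod_ge_0 (g w - g p)); pose proof (Cmod_ge_0 (h w - h p)).
  unfold M in *. nra.
Qed.

Lemma ccont_comp (g h : C -> C) (p : C) :
  ccont h p -> ccont g (h p) -> ccont (fun w => g (h w)) p.
Proof.
  intros hh hg eps he.
  destruct (hg eps he) as (d1 & p1 & h1). destruct (hh d1 p1) as (d2 & p2 & h2).
  exists d2; split; [exact p2|]. intros w hw. apply h1, h2, hw.
Qed.

Lemma ccont_id (p : C) : ccont (fun w => w) p.
Proof. intros eps he; exists eps; split; [exact he | intros w hw; exact hw]. Qed.

Lemma ccont_ext (g h : C -> C) (p : C) : (forall w, g w = h w) -> ccont g p -> ccont h p.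
Proof.
  intros e hg eps he. destruct (hg eps he) as (d & hd & k).
  exists d; split; [exact hd|]. intros w hw; rewrite <- !e; apply k, hw.
Qed.

Lemma cdiff_ccont (g : C -> C) (p : C) : cdiff g p -> ccont g p.
Proof.
  intros (q & hq & e).
  apply (ccont_ext (fun w => g p + q w * (w + - p))%C); [intro w; rewrite (e w); reflexivity|].
  apply ccont_plus; [apply ccont_const|]. apply ccont_mult; [exact hq|].
  apply ccont_plus; [apply ccont_id | apply ccont_const].
Qed.

Lemma cdiff_ext (g h : C -> C) (p : C) : (forall w, g w = h w) -> cdiff g p -> cdiff h p.
Proof.
  intros e (q & hq & eq). exists q; split; [exact hq|]. intro w; rewrite <- !e; apply eq.
Qed.

Lemma cdiff_const (c p : C) : cdiff (fun _ => c) p.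
Proof. exists (fun _ => RtoC 0); split; [apply ccont_const | intro w; ring]. Qed.

Lemma cdiff_id (p : C) : cdiff (fun w => w) p.
Proof. exists (fun _ => RtoC 1); split; [apply ccont_const | intro w; ring]. Qed.

Lemma cdiff_plus (g h : C -> C) (p : C) :
  cdiff g p -> cdiff h p -> cdiff (fun w => g w + h w)%C p.
Proof.
  intros (q1 & c1 & e1) (q2 & c2 & e2). exists (fun w => q1 w + q2 w)%C; split.
  - apply ccont_plus; assumption.
  - intro w; rewrite (e1 w), (e2 w); ring.
Qed.

Lemma cdiff_mult (g h : C -> C) (p : C) :
  cdiff g p -> cdiff h p -> cdiff (fun w => g w * h w)%C p.
Proof.
  intros (q1 & c1 & e1) Hh. assert (ch := cdiff_ccont h p Hh).
  destruct Hh as (q2 & c2 & e2). exists (fun w => q1 w * h w + g p * q2 w)%C; split.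
  - apply ccont_plus; apply ccont_mult; try assumption. apply ccont_const.
  - intro w; rewrite (e1 w), (e2 w); ring.
Qed.

Lemma cdiff_comp (g h : C -> C) (p : C) :
  cdiff h p -> cdiff g (h p) -> cdiff (fun w => g (h w)) p.
Proof.
  intros Hh (q1 & c1 & e1). assert (ch := cdiff_ccont h p Hh).
  destruct Hh as (q2 & c2 & e2). exists (fun w => q1 (h w) * q2 w)%C; split.
  - apply ccont_mult; [|exact c2]. apply (ccont_comp q1 h p ch c1).
  - intro w. rewrite (e1 (h w)).
    replace (h w - h p)%C with (q2 w * (w - p))%C by (rewrite (e2 w); ring). ring.
Qed.

(** The Caratheodory factor is the difference quotient with [l] filled in at [p]; the hypothesis
    says that it is continuous there. *)
Lemma cdiff_of_domin (g : C -> C) (p l : C) :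
  (forall eps : R, 0 < eps -> exists delta : R, 0 < delta /\ forall w : C,
    Cmod (w - p) < delta -> Cmod (g w - g p - l * (w - p)) <= eps * Cmod (w - p)) ->
  cdiff g p.
Proof.
  intro h.
  set (q := fun w => if excluded_middle_informative (w = p) then l
                     else ((g w - g p) / (w - p))%C).
  assert (qp : q p = l) by (unfold q; destruct (excluded_middle_informative _); congruence).
  exists q; split.
  - intros eps he. destruct (h (eps / 2)) as (d & hd & k); [lra|].
    exists d; split; [exact hd|]. intros w hw. rewrite qp.
    unfold q. destruct (excluded_middle_informative (w = p)) as [_|hne].
    + replace (l - l)%C with (RtoC 0) by ring. rewrite Cmod_0; exact he.
    + assert (hz : (w - p <> 0)%C).
      { intro e. apply hne. replace w with (w - p + p)%C by ring. rewrite e; ring. }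
      replace ((g w - g p) / (w - p) - l)%C with ((g w - g p - l * (w - p)) / (w - p))%C
        by (field; exact hz).
      rewrite Cmod_div by exact hz. apply Cmod_gt_0 in hz.
      apply Rle_lt_trans with (eps / 2); [|lra].
      apply Rle_div_l; [lra|]. apply k, hw.
  - intro w. unfold q. destruct (excluded_middle_informative (w = p)) as [->|hne].
    + ring.
    + field. intro e. apply hne. replace w with (w - p + p)%C by ring. rewrite e; ring.
Qed.

Lemma ex_derive_cdiff (g : C -> C) (p : C) : @ex_derive C_AbsRing C_NormedModule g p -> cdiff g p.
Proof.
  intros [l [_ hl]]. apply (cdiff_of_domin g p l). intros eps he.
  specialize (hl p (fun P hP => hP) (mkposreal eps he)).
  destruct hl as [d hd]. exists d; split; [apply cond_pos|].
  intros w hw.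
  replace (l * (w - p))%C with ((w - p) * l)%C by ring.
  apply (hd w). exact hw.
Qed.

(** * The complex exponential *)

Definition cexp (w : C) : C := (exp (Re w) * cos (Im w), exp (Re w) * sin (Im w)).

Lemma cexp_plus (v w : C) : cexp (v + w) = (cexp v * cexp w)%C.
Proof.
  destruct v as [x y], w as [x' y']; unfold cexp; apply injective_projections; simpl;
    rewrite exp_plus, ?cos_plus, ?sin_plus; ring.
Qed.

Lemma Cmod_cexp (w : C) : Cmod (cexp w) = exp (Re w).
Proof.
  unfold Cmod, cexp; simpl.
  replace (_ + _) with (exp (Re w) ^ 2 * ((sin (Im w))² + (cos (Im w))²))
    by (unfold Rsqr; ring).
  rewrite sin2_cos2, Rmult_1_r, sqrt_pow2; [reflexivity | left; apply exp_pos].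
Qed.

Lemma derive_domin_0 (g : R -> R) (l : R) : is_derive g 0 l ->
  forall eps, 0 < eps -> exists delta, 0 < delta /\
    forall x, Rabs x < delta -> Rabs (g x - g 0 - l * x) <= eps * Rabs x.
Proof.
  intros [_ h] eps he. specialize (h 0 (fun P hP => hP) (mkposreal eps he)).
  destruct h as [d hd]. exists d; split; [apply cond_pos|]. intros x hx.
  specialize (hd x). unfold norm, minus, plus, opp, scal in hd; simpl in hd.
  unfold mult, abs in hd; simpl in hd.
  replace (g x - g 0 - l * x) with (g x + - g 0 + - ((x + - 0) * l)) by ring.
  replace (Rabs x) with (Rabs (x + - 0)) by (f_equal; ring).
  apply hd. unfold ball; simpl; unfold AbsRing_ball, abs, minus, plus, opp; simpl.
  rewrite Ropp_0, Rplus_0_r; exact hx.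
Qed.

(** The addition law reduces every point to 0, where the first-order expansions of exp, cos and sin
    suffice. *)
Lemma cdiff_cexp (p : C) : cdiff cexp p.
Proof.
  assert (h0 : cdiff cexp 0).
  { apply (cdiff_of_domin cexp 0 1). intros eps he.
    (* With m the modulus of the increment, the real part errs by at most 4 e m and the imaginary
       part by at most 5 e m, so eps / 12 leaves room. *)
    set (e := Rmin 1 (eps / 12)).
    assert (e0 : 0 < e) by (apply Rmin_pos; lra).
    assert (e1 : e <= 1) by apply Rmin_l.
    assert (e2 : e <= eps / 12) by apply Rmin_r.
    destruct (derive_domin_0 exp 1 ltac:(auto_derive; [exact I | rewrite exp_0; ring]) e e0)
      as (d1 & p1 & h1).
    destruct (derive_domin_0 cos 0 ltac:(auto_derive; [exact I | rewrite sin_0; ring]) e e0)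
      as (d2 & p2 & h2).
    destruct (derive_domin_0 sin 1 ltac:(auto_derive; [exact I | rewrite cos_0; ring]) e e0)
      as (d3 & p3 & h3).
    exists (Rmin e (Rmin d1 (Rmin d2 d3))); split.
    { repeat apply Rmin_pos; lra. }
    intros [x y] hw. replace ((x, y) - 0)%C with ((x, y) : C) in *
      by (apply injective_projections; simpl; ring).
    pose proof (Rmin_l e (Rmin d1 (Rmin d2 d3))). pose proof (Rmin_r e (Rmin d1 (Rmin d2 d3))).
    pose proof (Rmin_l d1 (Rmin d2 d3)). pose proof (Rmin_r d1 (Rmin d2 d3)).
    pose proof (Rmin_l d2 d3). pose proof (Rmin_r d2 d3).
    pose proof (re_le_Cmod (x, y)) as hx. pose proof (im_le_Cmod (x, y)) as hy.
    simpl in hx, hy. set (m := Cmod (x, y)) in *.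
    specialize (h1 x ltac:(lra)). specialize (h2 y ltac:(lra)). specialize (h3 y ltac:(lra)).
    rewrite exp_0 in h1. rewrite cos_0 in h2. rewrite sin_0 in h3.
    eapply Rle_trans; [apply Cmod_le_abs|].
    unfold cexp; simpl. rewrite exp_0, cos_0, sin_0.
    assert (m0 : 0 <= m) by apply Cmod_ge_0.
    set (E := exp x - 1 - 1 * x) in *. set (K := cos y - 1 - 0 * y) in *.
    set (S := sin y - 0 - 1 * y) in *.
    replace (exp x) with (1 + x + E) by (unfold E; ring).
    replace (cos y) with (1 + K) by (unfold K; ring).
    replace (sin y) with (y + S) by (unfold S; ring).
    assert (b1 : Rabs E <= e * m) by (eapply Rle_trans; [exact h1|]; nra).
    assert (b2 : Rabs K <= e * m) by (eapply Rle_trans; [exact h2|]; nra).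
    assert (b3 : Rabs S <= e * m) by (eapply Rle_trans; [exact h3|]; nra).
    assert (b4 : Rabs (1 + x + E) <= 3).
    { pose proof (Rabs_triang (1 + x) E). pose proof (Rabs_triang 1 x).
      rewrite Rabs_R1 in *. nra. }
    assert (b5 : Rabs (x + E) <= 2 * m).
    { pose proof (Rabs_triang x E). nra. }
    assert (c1 : Rabs ((1 + x + E) * K) <= 3 * (e * m)).
    { rewrite Rabs_mult. apply Rmult_le_compat; try apply Rabs_pos; assumption. }
    assert (c2 : Rabs ((1 + x + E) * S) <= 3 * (e * m)).
    { rewrite Rabs_mult. apply Rmult_le_compat; try apply Rabs_pos; assumption. }
    assert (c3 : Rabs ((x + E) * y) <= 2 * m * e).
    { rewrite Rabs_mult. apply Rmult_le_compat; try apply Rabs_pos; try assumption. lra. }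
    pose proof (Rabs_triang E ((1 + x + E) * K)) as t1.
    pose proof (Rabs_triang ((x + E) * y) ((1 + x + E) * S)) as t2.
    match goal with |- Rabs ?A + Rabs ?B <= _ =>
      replace A with (E + (1 + x + E) * K) by ring;
      replace B with ((x + E) * y + (1 + x + E) * S) by ring end.
    nra. }
  apply (cdiff_ext (fun w => cexp p * cexp (w + - p))%C).
  { intro w. rewrite <- cexp_plus. f_equal; ring. }
  apply cdiff_mult; [apply cdiff_const|].
  apply (cdiff_comp cexp (fun w => w + - p)%C p).
  - apply cdiff_plus; [apply cdiff_id | apply cdiff_const].
  - replace (p + - p)%C with (RtoC 0) by ring. exact h0.
Qed.

(** * From complex differentiability to the mean value property on circles *)

Lemma continuous_of_Rabs (g : R -> R) (x : R) :
  (forall eps, 0 < eps -> exists delta, 0 < delta /\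
    forall s, Rabs (s - x) < delta -> Rabs (g s - g x) < eps) -> continuous g x.
Proof.
  intro h. apply filterlim_locally. intros [eps he].
  destruct (h eps he) as (d & hd & k). exists (mkposreal d hd). intros s hs. apply k, hs.
Qed.

(** For U = Re g and V = Im g, the form V dx + U dy is the imaginary part of g dw. Its boundary
    integral meets Im g on horizontal sides and Re g on vertical ones. *)
Lemma continuous_re_im_slices (g : C -> C) (x y : R) : ccont g (x, y) ->
  continuous (fun s => Im (g (s, y))) x /\ continuous (fun s => Re (g (x, s))) y.
Proof.
  intro h; split; apply continuous_of_Rabs; intros eps he;
    destruct (h eps he) as (d & hd & k); exists d; (split; [exact hd|]); intros s hs.
  - assert (K : Cmod (g (s, y) - g (x, y)) < eps).
    { apply k. replace ((s, y) - (x, y))%C with (RtoC (s - x))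
        by (apply injective_projections; simpl; ring). rewrite Cmod_R; exact hs. }
    eapply Rle_lt_trans; [|exact K]. apply (im_le_Cmod (g (s, y) - g (x, y))).
  - assert (K : Cmod (g (x, s) - g (x, y)) < eps).
    { apply k. replace ((x, s) - (x, y))%C with (Ci * RtoC (s - y))%C
        by (apply injective_projections; simpl; ring).
      rewrite Cmod_mult, Cmod_Ci, Rmult_1_l, Cmod_R; exact hs. }
    eapply Rle_lt_trans; [|exact K]. apply (re_le_Cmod (g (x, s) - g (x, y))).
Qed.

(** Multiplication by the derivative q has equal diagonal entries Re q. This Cauchy-Riemann
    equation, U_x = V_y, is the closedness of V dx + U dy and appears as the shared coefficient
    [u1]. *)
Lemma cdiff_closed_form (g : C -> C) (x y : R) : cdiff g (x, y) ->
  exists u1 u2 v1 : R, forall eps : R, 0 < eps -> exists delta : R, 0 < delta /\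
    forall x' y' : R, Rabs (x' - x) < delta -> Rabs (y' - y) < delta ->
      Rabs (Re (g (x', y')) - (Re (g (x, y)) + u1 * (x' - x) + u2 * (y' - y))) <=
        eps * (Rabs (x' - x) + Rabs (y' - y)) /\
      Rabs (Im (g (x', y')) - (Im (g (x, y)) + v1 * (x' - x) + u1 * (y' - y))) <=
        eps * (Rabs (x' - x) + Rabs (y' - y)).
Proof.
  intros (q & hq & e).
  exists (Re (q (x, y))), (- Im (q (x, y))), (Im (q (x, y))).
  intros eps he. destruct (hq eps he) as (d & hd & k).
  exists (d / 2); split; [lra|]. intros x' y' hx hy.
  pose proof (Cmod_le_abs ((x', y') - (x, y))) as hn. simpl in hn.
  specialize (k (x', y') ltac:(unfold Rminus in *; lra)).
  assert (K : Cmod ((q (x', y') - q (x, y)) * ((x', y') - (x, y))) <=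
    eps * (Rabs (x' - x) + Rabs (y' - y))).
  { rewrite Cmod_mult. apply Rmult_le_compat; try apply Cmod_ge_0; [lra|exact hn]. }
  rewrite (e (x', y')). split; (eapply Rle_trans; [|exact K]).
  - eapply Rle_trans; [|apply re_le_Cmod]. right; f_equal; simpl; unfold Re, Im; ring.
  - eapply Rle_trans; [|apply im_le_Cmod]. right; f_equal; simpl; unfold Re, Im; ring.
Qed.

(* Goursat's theorem for k (cexp w) on a rectangle of height 2 PI, whose horizontal sides
   cancel by periodicity; the left side tends to - oo, where cexp w tends to 0. *)
Lemma mean_value_0 (k : C -> C) (R0 : R) :
  (forall z, Cmod z < R0 -> cdiff k z) -> k 0 = RtoC 0 ->
  forall rho, exp rho < R0 ->
    RInt (fun theta => Re (k (cexp (rho, theta)))) (- PI / 2) (3 * PI / 2) = 0.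
Proof.
  intros hk k0 rho hrho.
  pose proof PI_RGT_0 as hpi.
  set (U := fun x y => Re (k (cexp (x, y)))). set (V := fun x y => Im (k (cexp (x, y)))).
  assert (hH : forall x y, x <= rho -> cdiff (fun w => k (cexp w)) (x, y)).
  { intros x y hx. apply cdiff_comp; [apply cdiff_cexp|]. apply hk.
    rewrite Cmod_cexp; simpl. eapply Rle_lt_trans; [|exact hrho].
    destruct hx as [hx| ->]; [left; apply exp_increasing, hx | right; reflexivity]. }
  assert (hconst : forall rho0, rho0 <= rho ->
    RInt (fun y => U rho y) (- PI / 2) (3 * PI / 2) =
    RInt (fun y => U rho0 y) (- PI / 2) (3 * PI / 2)).
  { intros rho0 h0.
    assert (B : boundary_int U V rho0 rho (- PI / 2) (3 * PI / 2) = 0).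
    { apply boundary_int_closed_form; try lra.
      - intros x y hx hy. apply (continuous_re_im_slices (fun w => k (cexp w))).
        apply cdiff_ccont, hH, hx.
      - intros x y hx hy. apply (cdiff_closed_form (fun w => k (cexp w))), hH, hx. }
    unfold boundary_int in B.
    assert (per : RInt (fun x => V x (- PI / 2)) rho0 rho = RInt (fun x => V x (3 * PI / 2)) rho0 rho).
    { apply RInt_ext. intros x _. unfold V, cexp; simpl.
      replace (3 * PI / 2) with (- PI / 2 + 2 * INR 1 * PI) by (simpl; field).
      rewrite sin_period, cos_period. reflexivity. }
    lra. }
  change (RInt (fun y => U rho y) (- PI / 2) (3 * PI / 2) = 0).
  apply NNPP; intro hne. set (I := RInt (fun y => U rho y) (- PI / 2) (3 * PI / 2)) in *.
  assert (hI : 0 < Rabs I) by (apply Rabs_pos_lt; exact hne).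
  assert (hR0 : 0 < R0) by (pose proof (exp_pos rho); lra).
  assert (c0 : ccont k 0) by (apply cdiff_ccont, hk; rewrite Cmod_0; exact hR0).
  (* On an interval of length 2 PI this bound on the integrand forces |I| <= |I| / 2. *)
  destruct (c0 (Rabs I / (4 * PI))) as (d & hd & hkd); [apply Rdiv_lt_0_compat; lra|].
  (* The left side is moved to where |[cexp]| is at most d / 2, inside the disc on which [k] is
     small. *)
  set (rho0 := Rmin rho (ln (d / 2))).
  assert (h0 : rho0 <= rho) by apply Rmin_l.
  assert (h1 : exp rho0 < d).
  { apply Rle_lt_trans with (d / 2); [|lra].
    rewrite <- (exp_ln (d / 2)) by lra.
    destruct (Rmin_r rho (ln (d / 2))) as [h|h]; [left; apply exp_increasing; exact h|].
    unfold rho0; rewrite h; right; reflexivity. }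
  assert (b : Rabs I <= (3 * PI / 2 - - PI / 2) * (Rabs I / (4 * PI))).
  { rewrite (hconst rho0 h0) at 1.
    apply abs_RInt_le_const; [lra | |].
    - apply (ex_RInt_continuous (fun y => U rho0 y)). intros y _.
      apply (continuous_re_im_slices (fun w => k (cexp w))), cdiff_ccont, hH, h0.
    - intros y _. left. eapply Rle_lt_trans; [apply re_le_Cmod|].
      replace (k (cexp (rho0, y))) with (k (cexp (rho0, y)) - k 0)%C by (rewrite k0; ring).
      apply hkd. replace (cexp (rho0, y) - 0)%C with (cexp (rho0, y)) by ring.
      rewrite Cmod_cexp; simpl; exact h1. }
  replace ((3 * PI / 2 - - PI / 2) * (Rabs I / (4 * PI))) with (Rabs I / 2) in b by (field; lra).
  lra.
Qed.

(** * Functions harmonic to third order and their maximum principle *)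

(* Third order is enough for the maximum principle, and ln |1 + w| = Re (w - w^2 / 2) + O(w^3)
   then makes a complex logarithm unnecessary. *)
Definition near_harmonic (u : C -> R) (p : C) : Prop :=
  exists (k : C -> C) (K R0 : R), 0 < R0 /\ k 0 = RtoC 0 /\
    (forall z, Cmod z < R0 -> cdiff k z) /\
    (forall z, Cmod z < R0 -> Rabs (u (p + z)%C - u p - Re (k z)) <= K * Cmod z ^ 3).

Lemma near_harmonic_plus (u v : C -> R) (p : C) :
  near_harmonic u p -> near_harmonic v p -> near_harmonic (fun w => u w + v w) p.
Proof.
  intros (k1 & K1 & R1 & p1 & z1 & d1 & h1) (k2 & K2 & R2 & p2 & z2 & d2 & h2).
  exists (fun z => k1 z + k2 z)%C, (K1 + K2), (Rmin R1 R2).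
  assert (m1 := Rmin_l R1 R2). assert (m2 := Rmin_r R1 R2).
  repeat split.
  - apply Rmin_pos; assumption.
  - rewrite z1, z2; ring.
  - intros z hz. apply cdiff_plus; [apply d1 | apply d2]; lra.
  - intros z hz. specialize (h1 z ltac:(lra)). specialize (h2 z ltac:(lra)).
    match goal with |- Rabs ?A <= _ => replace A with
      ((u (p + z)%C - u p - Re (k1 z)) + (v (p + z)%C - v p - Re (k2 z))) end.
    + eapply Rle_trans; [apply Rabs_triang|]. lra.
    + simpl; unfold Re; ring.
Qed.

Lemma near_harmonic_scal (c : R) (u : C -> R) (p : C) :
  near_harmonic u p -> near_harmonic (fun w => c * u w) p.
Proof.
  intros (k & K & R0 & p0 & z0 & d0 & h0).
  exists (fun z => c * k z)%C, (Rabs c * K), R0. repeat split.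
  - exact p0.
  - rewrite z0; ring.
  - intros z hz. apply cdiff_mult; [apply cdiff_const | apply d0, hz].
  - intros z hz.
    match goal with |- Rabs ?A <= _ => replace A with
      (c * (u (p + z)%C - u p - Re (k z))) end.
    + rewrite Rabs_mult, Rmult_assoc. apply Rmult_le_compat_l; [apply Rabs_pos | apply h0, hz].
    + simpl; unfold Re; ring.
Qed.

Lemma near_harmonic_Re (g : C -> C) (p : C) :
  (forall z, cdiff g z) -> near_harmonic (fun w => Re (g w)) p.
Proof.
  intro hg. exists (fun z => g (p + z) + - g p)%C, 0, 1. repeat split.
  - lra.
  - replace (p + 0)%C with p by ring. ring.
  - intros z _. apply cdiff_plus; [|apply cdiff_const].
    apply (cdiff_comp g (fun z => p + z)%C); [|apply hg].
    apply cdiff_plus; [apply cdiff_const | apply cdiff_id].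
  - intros z _. simpl. unfold Re.
    match goal with |- Rabs ?A <= _ => replace A with 0 by ring end.
    rewrite Rabs_R0; lra.
Qed.

(** The remainder has derivative x^2 / (1 + x), so the mean value theorem bounds it by a multiple of
    |s|^3. The range 9 / 16 is what |w| <= 1 / 4 produces below; it gives 1 + c >= 7 / 16, and 16 /
    7 <= 3. *)
Lemma ln_1_plus_taylor (s : R) : Rabs s <= 9 / 16 ->
  Rabs (ln (1 + s) - (s - s ^ 2 / 2)) <= 3 * Rabs s ^ 3.
Proof.
  intro hs. apply Rabs_le_between in hs.
  destruct (MVT_gen (fun x => ln (1 + x) - (x - x ^ 2 / 2)) 0 s (fun x => x ^ 2 / (1 + x)))
    as (c & hc & e).
  - intros x hx. assert (0 < 1 + x).
    { unfold Rmin in hx; destruct (Rle_dec 0 s); lra. }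
    auto_derive; [lra|]. field; lra.
  - intros x hx. apply continuity_pt_filterlim.
    assert (0 < 1 + x) by (unfold Rmin in hx; destruct (Rle_dec 0 s); lra).
    apply (ex_derive_continuous (fun x => ln (1 + x) - (x - x ^ 2 / 2))).
    auto_derive; lra.
  - replace (1 + 0) with 1 in e by ring. rewrite ln_1 in e.
    replace (ln (1 + s) - (s - s ^ 2 / 2)) with (c ^ 2 / (1 + c) * s) by lra.
    assert (hcs : Rabs c <= Rabs s /\ 7 / 16 <= 1 + c).
    { unfold Rmin, Rmax in hc; destruct (Rle_dec 0 s); split;
      (rewrite ?(Rabs_pos_eq c), ?(Rabs_pos_eq s), ?(Rabs_left1 c), ?(Rabs_left1 s) by lra; lra)
      || lra. }
    destruct hcs as [h1 h2]. rewrite Rabs_mult.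
    replace (3 * Rabs s ^ 3) with (3 * Rabs s ^ 2 * Rabs s) by ring.
    apply Rmult_le_compat_r; [apply Rabs_pos|].
    unfold Rdiv; rewrite Rabs_mult, Rabs_inv, <- RPow_abs, (Rabs_pos_eq (1 + c)) by lra.
    assert (Rabs c ^ 2 <= Rabs s ^ 2) by (apply pow_incr; split; [apply Rabs_pos | lra]).
    assert (/ (1 + c) <= 16 / 7).
    { replace (16 / 7) with (/ (7 / 16)) by field. apply Rinv_le_contravar; lra. }
    assert (0 < / (1 + c)) by (apply Rinv_0_lt_compat; lra).
    assert (0 <= Rabs c ^ 2) by (apply pow_le, Rabs_pos). nra.
Qed.

(** Since |1 + w|^2 = 1 + s with s = 2 x + |w|^2, the left logarithm is half of ln (1 + s), and the
    terms of order at most two agree with Re (w - w^2 / 2). The cubic error is at most (3 / 2) (9 /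
    4)^3 + 1 + 1 / 4 < 20 times |w|^3. *)
Lemma ln_Cmod_1_plus_taylor (w : C) : Cmod w <= / 4 ->
  Rabs (ln (Cmod (1 + w)) - Re (w + - / 2 * (w * w))%C) <= 20 * Cmod w ^ 3.
Proof.
  intro hw. destruct w as [x y].
  assert (hm := Cmod2_alt (x, y)). simpl Re in hm; simpl Im in hm.
  assert (hx := re_le_Cmod (x, y)). simpl in hx. apply Rabs_le_between in hx.
  set (m := Cmod (x, y)) in *. assert (m0 : 0 <= m) by apply Cmod_ge_0.
  set (s := 2 * x + m ^ 2).
  assert (hs : Rabs s <= 9 / 4 * m) by (apply Rabs_le; unfold s; nra).
  assert (h1s : 0 < 1 + s) by (apply Rabs_le_between in hs; nra).
  assert (e : ln (Cmod (1 + (x, y))) = / 2 * ln (1 + s)).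
  { assert (e2 : Cmod (1 + (x, y)) ^ 2 = 1 + s).
    { rewrite Cmod2_alt. simpl Re; simpl Im. unfold s; rewrite hm. ring. }
    assert (hpos : 0 < Cmod (1 + (x, y))).
    { destruct (Cmod_ge_0 (1 + (x, y))) as [h|h]; [exact h|]. rewrite <- h in e2. nra. }
    rewrite <- e2, ln_pow by exact hpos. simpl; field. }
  rewrite e.
  assert (T := ln_1_plus_taylor s ltac:(lra)).
  assert (hs3 : Rabs s ^ 3 <= (9 / 4 * m) ^ 3) by (apply pow_incr; split; [apply Rabs_pos | lra]).
  apply Rabs_le_between in T.
  assert (eR : Re ((x, y) + - / 2 * ((x, y) * (x, y)))%C = x - (x ^ 2 - y ^ 2) / 2).
  { simpl. unfold Re; simpl. field. }
  rewrite eR.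
  assert (ex : / 2 * (s - s ^ 2 / 2) - (x - (x ^ 2 - y ^ 2) / 2) = - x * m ^ 2 - m ^ 4 / 4).
  { assert (hy : y ^ 2 = m ^ 2 - x ^ 2) by lra. rewrite hy. unfold s. field. }
  assert (m3 : 0 <= m ^ 3) by (apply pow_le; exact m0).
  assert (b1 : Rabs (x * m ^ 2) <= m ^ 3).
  { rewrite Rabs_mult, (Rabs_pos_eq (m ^ 2)) by (apply pow_le; exact m0).
    replace (m ^ 3) with (m * m ^ 2) by ring.
    apply Rmult_le_compat_r; [apply pow_le; exact m0 | apply Rabs_le; lra]. }
  apply Rabs_le_between in b1.
  assert (b2 : 0 <= m ^ 4 <= m ^ 3) by (replace (m ^ 4) with (m * m ^ 3) by ring; nra).
  replace ((9 / 4 * m) ^ 3) with (729 / 64 * m ^ 3) in hs3 by field.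
  apply Rabs_le. lra.
Qed.

(** Division by G p reduces to ln |1 + g| with g z = G (p + z) / G p - 1, and k = g - g^2 / 2 is
    holomorphic near 0. A linear bound |g z| <= M |z| turns the cubic error in g into one in z. *)
Lemma near_harmonic_ln_Cmod (G : C -> C) (p : C) (d : R) :
  0 < d -> (forall w, Cmod (w - p) < d -> cdiff G w) -> G p <> RtoC 0 ->
  near_harmonic (fun w => ln (Cmod (G w))) p.
Proof.
  intros hd hG hp.
  assert (hGp : cdiff G p).
  { apply hG. replace (p - p)%C with (RtoC 0) by ring. rewrite Cmod_0; exact hd. }
  destruct hGp as (q & hq & eq).
  set (g := fun z => (/ G p * G (p + z) + - RtoC 1)%C).
  destruct (hq 1 ltac:(lra)) as (d1 & hd1 & hq1).
  (* The factor [q] stays within 1 of its value at [p] on the disc of radius [d1]; the radius 1 / (4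
     M) below ensures |g z| <= 1 / 4. *)
  set (M := (Cmod (q p) + 1) / Cmod (G p)).
  assert (hG0 := proj1 (Cmod_gt_0 (G p)) hp).
  assert (hM : 0 < M).
  { apply Rdiv_lt_0_compat; [|exact hG0]. pose proof (Cmod_ge_0 (q p)); lra. }
  assert (hgM : forall z, Cmod z < d1 -> Cmod (g z) <= M * Cmod z).
  { intros z hz. unfold g. rewrite (eq (p + z)%C).
    replace (p + z - p)%C with z by ring.
    replace (/ G p * (G p + q (p + z) * z) + - (1))%C with (q (p + z) / G p * z)%C
      by (field; exact hp).
    rewrite Cmod_mult, Cmod_div by exact hp.
    apply Rmult_le_compat_r; [apply Cmod_ge_0|].
    apply Rmult_le_compat_r; [left; apply Rinv_0_lt_compat; exact hG0|].
    replace (q (p + z)%C) with (q p + (q (p + z) - q p))%C by ring.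
    eapply Rle_trans; [apply Cmod_triangle|]. apply Rplus_le_compat_l.
    left; apply hq1. replace (p + z - p)%C with z by ring. exact hz. }
  exists (fun z => g z + - / 2 * (g z * g z))%C, (20 * M ^ 3), (Rmin d (Rmin d1 (/ (4 * M)))).
  assert (h4M : 0 < / (4 * M)) by (apply Rinv_0_lt_compat; lra).
  assert (m1 := Rmin_l d (Rmin d1 (/ (4 * M)))). assert (m2 := Rmin_r d (Rmin d1 (/ (4 * M)))).
  assert (m3 := Rmin_l d1 (/ (4 * M))). assert (m4 := Rmin_r d1 (/ (4 * M))).
  repeat split.
  - repeat apply Rmin_pos; assumption.
  - assert (g0 : g 0 = RtoC 0).
    { unfold g. replace (p + 0)%C with p by ring. field; exact hp. }
    rewrite g0; ring.
  - intros z hz.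
    assert (hgz : cdiff g z).
    { unfold g. apply cdiff_plus; [|apply cdiff_const].
      apply cdiff_mult; [apply cdiff_const|].
      apply (cdiff_comp G (fun z => p + z)%C).
      - apply cdiff_plus; [apply cdiff_const | apply cdiff_id].
      - apply hG. replace (p + z - p)%C with z by ring. lra. }
    apply cdiff_plus; [exact hgz|]. apply cdiff_mult; [apply cdiff_const|].
    apply cdiff_mult; exact hgz.
  - intros z hz.
    assert (hgz := hgM z ltac:(lra)).
    assert (hz0 := Cmod_ge_0 z). assert (hg0 := Cmod_ge_0 (g z)).
    assert (hM4 : M * Cmod z <= / 4).
    { apply Rle_trans with (M * / (4 * M)); [apply Rmult_le_compat_l; lra|].
      right; field; lra. }
    assert (T := ln_Cmod_1_plus_taylor (g z) ltac:(lra)).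
    assert (h1 : 0 < Cmod (1 + g z)).
    { assert (tr := Cmod_triangle (1 + g z) (- g z)).
      replace (1 + g z + - g z)%C with (RtoC 1) in tr by ring.
      rewrite Cmod_1, Cmod_opp in tr. lra. }
    replace (ln (Cmod (G (p + z)%C))) with (ln (Cmod (G p)) + ln (Cmod (1 + g z))).
    + match goal with |- Rabs ?A <= _ => replace A with
        (ln (Cmod (1 + g z)) - Re (g z + - / 2 * (g z * g z))%C) by ring end.
      eapply Rle_trans; [exact T|].
      replace (20 * M ^ 3 * Cmod z ^ 3) with (20 * (M * Cmod z) ^ 3) by ring.
      apply Rmult_le_compat_l; [lra|]. apply pow_incr; lra.
    + rewrite <- ln_mult by assumption. f_equal. rewrite <- Cmod_mult. f_equal.
      unfold g. field; exact hp.
Qed.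

(** Re k has mean 0 on small circles, and so has its reflection; hence its reflected sums have mean
    0. The hypothesis bounds them by - eta r^2 + 2 |K| r^3, which is negative for small r. *)
Lemma near_harmonic_no_strict_max (u : C -> R) (p : C) (eta delta : R) :
  near_harmonic u p -> 0 < eta -> 0 < delta ->
  (forall x y, 0 < Cmod (x, y) < delta ->
    u (p + (x, y))%C + u (p + ((- x)%R, y))%C - 2 * u p <= - eta * Cmod (x, y) ^ 2) ->
  False.
Proof.
  intros (k & K & R0 & hR & k0 & dk & hk) he hd h.
  pose proof PI_RGT_0 as hpi.
  (* The last entry gives 2 |K| r <= eta / 2, so the quadratic term wins over the cubic error. *)
  set (r := Rmin (R0 / 2) (Rmin (delta / 2) (eta / (4 * (Rabs K + 1))))).
  assert (hK := Rabs_pos K).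
  assert (hr : 0 < r).
  { unfold r. repeat apply Rmin_pos; try lra. apply Rdiv_lt_0_compat; lra. }
  assert (hr1 : r < R0) by (apply Rle_lt_trans with (R0 / 2); [apply Rmin_l | lra]).
  assert (hr' := Rmin_r (R0 / 2) (Rmin (delta / 2) (eta / (4 * (Rabs K + 1))))).
  fold r in hr'.
  assert (hr2 : r < delta).
  { pose proof (Rmin_l (delta / 2) (eta / (4 * (Rabs K + 1)))). lra. }
  assert (hr3 : r * (4 * (Rabs K + 1)) <= eta).
  { apply Rle_trans with (eta / (4 * (Rabs K + 1)) * (4 * (Rabs K + 1))).
    - apply Rmult_le_compat_r; [lra|].
      pose proof (Rmin_r (delta / 2) (eta / (4 * (Rabs K + 1)))). lra.
    - right; field; lra. }
  set (rho := ln r). assert (erho : exp rho = r) by (apply exp_ln; exact hr).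
  set (W := fun th => Re (k (cexp (rho, th)))).
  assert (cm : forall th, Cmod (cexp (rho, th)) = r) by (intro; rewrite Cmod_cexp; exact erho).
  assert (hW : RInt W (- PI / 2) (3 * PI / 2) = 0).
  { apply (mean_value_0 k R0 dk k0 rho). lra. }
  assert (cW : forall th, continuous W th).
  { intro th. apply (continuous_re_im_slices (fun w => k (cexp w)) rho th).
    apply cdiff_ccont, cdiff_comp; [apply cdiff_cexp | apply dk; rewrite cm; exact hr1]. }
  assert (iW : forall c d, ex_RInt W c d) by (intros; apply (ex_RInt_continuous W); intros; apply cW).
  assert (hpt : forall th, W th + W (PI - th) <= - eta * r ^ 2 + 2 * Rabs K * r ^ 3).
  { intro th.
    assert (e : cexp (rho, PI - th) = (- fst (cexp (rho, th)), snd (cexp (rho, th)))).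
    { unfold cexp; simpl. rewrite cos_minus, sin_minus, cos_PI, sin_PI.
      f_equal; ring. }
    assert (c1 := cm th). assert (c2 := cm (PI - th)).
    unfold W. rewrite e in *. destruct (cexp (rho, th)) as [x y]; simpl fst in *; simpl snd in *.
    assert (h1 := hk (x, y) ltac:(lra)). assert (h2 := hk (- x, y) ltac:(lra)).
    specialize (h x y ltac:(lra)). rewrite c1 in *; rewrite c2 in *.
    apply Rabs_le_between in h1. apply Rabs_le_between in h2.
    assert (K * r ^ 3 <= Rabs K * r ^ 3).
    { apply Rmult_le_compat_r; [apply pow_le; lra | apply Rle_abs]. }
    lra. }
  assert (hneg : - eta * r ^ 2 + 2 * Rabs K * r ^ 3 < 0).
  { replace (- eta * r ^ 2 + 2 * Rabs K * r ^ 3) with (r ^ 2 * (2 * Rabs K * r - eta)) by ring.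
    assert (0 < r ^ 2) by (apply pow_lt; exact hr). nra. }
  set (c := - eta * r ^ 2 + 2 * Rabs K * r ^ 3) in *.
  (* The reflection is th -> PI - th, which maps [- PI / 2, 3 PI / 2] onto itself; this explains the
     choice of that period. The factor -1 is the derivative of the substitution, so the reflected
     sum is [minus W W']. *)
  set (W' := fun th => -1 * W (-1 * th + PI)).
  assert (hrefl : RInt W' (- PI / 2) (3 * PI / 2) = 0).
  { etransitivity; [apply (RInt_comp_lin W (-1) PI (- PI / 2) (3 * PI / 2)), iW|].
    replace (-1 * (- PI / 2) + PI) with (3 * PI / 2) by field.
    replace (-1 * (3 * PI / 2) + PI) with (- PI / 2) by field.
    rewrite <- (opp_RInt_swap W) by apply iW. rewrite hW. apply Ropp_0. }
  assert (irefl : ex_RInt W' (- PI / 2) (3 * PI / 2)) by (apply (ex_RInt_comp_lin W), iW).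
  assert (hsum := RInt_minus W W' _ _ (iW (- PI / 2) (3 * PI / 2)) irefl).
  rewrite hrefl, hW in hsum.
  assert (hle : RInt (fun th => minus (W th) (W' th)) (- PI / 2) (3 * PI / 2)
    <= RInt (fun _ => c) (- PI / 2) (3 * PI / 2)).
  { apply RInt_le; [lra | apply (ex_RInt_minus W); [apply iW | exact irefl]
      | apply (ex_RInt_const (V := R_NormedModule)) |].
    intros th _. unfold minus, plus, opp, W'; simpl.
    replace (-1 * th + PI) with (PI - th) by ring. specialize (hpt th). lra. }
  assert (hz : RInt (fun th => minus (W th) (W' th)) (- PI / 2) (3 * PI / 2) = 0).
  { etransitivity; [exact hsum | unfold minus, plus, opp; simpl; ring]. }
  rewrite hz, (RInt_const (V := R_CompleteNormedModule)) in hle.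
  unfold scal in hle; simpl in hle; unfold mult in hle; simpl in hle.
  nra.
Qed.

(** * Finite sums and interpolated exponents *)

Fixpoint rsum (r : nat) (u : nat -> R) : R :=
  match r with O => 0 | S n => rsum n u + u n end.

Lemma rsum_ext (r : nat) (u v : nat -> R) :
  (forall i, (i < r)%nat -> u i = v i) -> rsum r u = rsum r v.
Proof.
  induction r as [|r IH]; intro h; simpl; [reflexivity|].
  rewrite IH, h by (intros; try apply h; lia). reflexivity.
Qed.

Lemma rsum_le (r : nat) (u v : nat -> R) :
  (forall i, (i < r)%nat -> u i <= v i) -> rsum r u <= rsum r v.
Proof.
  induction r as [|r IH]; intro h; simpl; [lra|].
  apply Rplus_le_compat; [apply IH; intros; apply h; lia | apply h; lia].
Qed.

Lemma rsum_plus (r : nat) (u v : nat -> R) :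
  rsum r (fun i => u i + v i) = rsum r u + rsum r v.
Proof. induction r as [|r IH]; simpl; [ring | rewrite IH; ring]. Qed.

Lemma rsum_scal (r : nat) (c : R) (u : nat -> R) :
  rsum r (fun i => c * u i) = c * rsum r u.
Proof. induction r as [|r IH]; simpl; [ring | rewrite IH; ring]. Qed.

Lemma Rprod_S (r : nat) (F : nat -> R) : Rprod (S r) F = Rprod r F * F r.
Proof.
  unfold Rprod. rewrite seq_S, map_app, fold_right_app; simpl.
  rewrite Rmult_1_r. induction (map F (seq 0 r)) as [|x xs IH]; simpl.
  - ring.
  - rewrite IH; ring.
Qed.

Lemma Rprod_exp (r : nat) (u : nat -> R) : Rprod r (fun i => exp (u i)) = exp (rsum r u).
Proof.
  induction r as [|r IH].
  - simpl. rewrite exp_0. reflexivity.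
  - rewrite Rprod_S, IH. simpl. rewrite exp_plus. reflexivity.
Qed.

(** The total exponent of |G_i| in the interpolated bound. It is affine in [sigma] with slope (be -
    al) / (b - a), and its variation at reflected points is therefore opposite. *)
Definition weight (a b al be sigma : R) : R :=
  al * ((b - sigma) / (b - a)) + be * ((sigma - a) / (b - a)).

Lemma weight_bounds (a b al be sigma : R) : a < b -> 0 <= al -> 0 <= be -> a <= sigma <= b ->
  0 <= weight a b al be sigma <= al + be.
Proof.
  intros hab ha hb hs. unfold weight.
  assert (h1 : (b - sigma) / (b - a) = 1 - (sigma - a) / (b - a)) by (field; lra).
  assert (h2 : 0 <= (sigma - a) / (b - a)).
  { apply Rdiv_le_0_compat; lra. }
  assert (h3 : 0 <= (b - sigma) / (b - a)).
  { apply Rdiv_le_0_compat; lra. }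
  rewrite h1 in *. set (x := (sigma - a) / (b - a)) in *. nra.
Qed.

Lemma near_harmonic_rsum (r : nat) (u : nat -> C -> R) (p : C) :
  (forall i, (i < r)%nat -> near_harmonic (u i) p) ->
  near_harmonic (fun w => rsum r (fun i => u i w)) p.
Proof.
  induction r as [|r IH]; intro h; simpl.
  - exists (fun _ => RtoC 0), 0, 1. repeat split; try lra.
    + intros z _; apply cdiff_const.
    + intros z _. simpl. replace (0 - 0 - 0) with 0 by ring. rewrite Rabs_R0; lra.
  - apply near_harmonic_plus; [apply IH; intros; apply h; lia | apply h; lia].
Qed.

(** * Continuity and holomorphy near points of the closed strip *)

Lemma ccont_continuous (u : C -> R) (p : C) :
  (forall eps, 0 < eps -> exists delta, 0 < delta /\
     forall w, Cmod (w - p) < delta -> Rabs (u w - u p) < eps) ->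
  @continuous C_UniformSpace R_UniformSpace u p.
Proof.
  intro h. apply filterlim_locally. intros [eps he].
  destruct (h eps he) as (d & hd & k). exists (mkposreal (d / 2) ltac:(lra)).
  intros w [h1 h2]. apply k.
  eapply Rle_lt_trans; [apply Cmod_le_abs|].
  change (Rabs (fst w - fst p) < d / 2) in h1. change (Rabs (snd w - snd p) < d / 2) in h2.
  change (Rabs (fst w - fst p) + Rabs (snd w - snd p) < d). lra.
Qed.

Lemma Cmod_triangle_rev (z w : C) : Rabs (Cmod z - Cmod w) <= Cmod (z - w).
Proof.
  assert (h1 := Cmod_triangle (z - w) w). assert (h2 := Cmod_triangle (w - z) z).
  replace (z - w + w)%C with z in h1 by ring. replace (w - z + z)%C with w in h2 by ring.
  replace (w - z)%C with (- (z - w))%C in h2 by ring. rewrite Cmod_opp in h2.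
  apply Rabs_le; lra.
Qed.

Lemma continuous_Cmod_comp (g : C -> C) (p : C) : ccont g p ->
  @continuous C_UniformSpace R_UniformSpace (fun w => Cmod (g w)) p.
Proof.
  intro h. apply ccont_continuous. intros eps he. destruct (h eps he) as (d & hd & k).
  exists d; split; [exact hd|]. intros w hw.
  eapply Rle_lt_trans; [apply Cmod_triangle_rev | apply k, hw].
Qed.

Lemma continuous_Re_comp (g : C -> C) (p : C) : ccont g p ->
  @continuous C_UniformSpace R_UniformSpace (fun w => Re (g w)) p.
Proof.
  intro h. apply ccont_continuous. intros eps he. destruct (h eps he) as (d & hd & k).
  exists d; split; [exact hd|]. intros w hw.
  eapply Rle_lt_trans; [apply (re_le_Cmod (g w - g p)) | apply k, hw].
Qed.

Lemma continuous_rsum (r : nat) (u : nat -> C -> R) (p : C) :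
  (forall i, (i < r)%nat -> @continuous C_UniformSpace R_UniformSpace (u i) p) ->
  @continuous C_UniformSpace R_UniformSpace (fun w => rsum r (fun i => u i w)) p.
Proof.
  induction r as [|r IH]; intro h; simpl.
  - apply continuous_const.
  - apply (continuous_plus (V := R_NormedModule) (fun w => rsum r (fun i => u i w)) (u r));
      [apply IH; intros; apply h; lia | apply h; lia].
Qed.

(** A whole disc is recorded because the expansion of ln |g| around [p] uses differentiability on a
    neighbourhood. *)
Definition hol_near (g : C -> C) (p : C) : Prop :=
  exists d : R, 0 < d /\ forall w, Cmod (w - p) < d -> cdiff g w.

Lemma hol_near_cdiff (g : C -> C) (p : C) : hol_near g p -> cdiff g p.
Proof.
  intros (d & hd & h). apply h. replace (p - p)%C with (RtoC 0) by ring.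
  rewrite Cmod_0; exact hd.
Qed.

Lemma holomorphic_on_hol_near (S : C -> Prop) (g : C -> C) (p : C) :
  holomorphic_on S g -> S p -> hol_near g p.
Proof.
  intros (U & hU & hS & hg) hp. destruct (hU p (hS p hp)) as [d hd].
  exists d; split; [apply cond_pos|]. intros w hw. apply ex_derive_cdiff, hg, hd.
  apply C_NormedModule_mixin_compat1. exact hw.
Qed.

Lemma exp_le_exp (x y : R) : x <= y -> exp x <= exp y.
Proof. intros [h| ->]; [left; apply exp_increasing, h | right; reflexivity]. Qed.

(** * The maximum principle on the strip *)

(** The estimate for one fixed [eps]. [L] is the logarithm of the interpolated bound, and [B] is any
    entire barrier with nonnegative real part on the strip that absorbs the growth of [f] beyond
    height [T]. This confines a violation to a compact rectangle. *)
Lemma strip_max_principle (a b : R) (r : nat) (G : nat -> C -> C) (f : C -> C)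
  (alpha beta : nat -> R) (T0 : R) (B : C -> C) (eps T : R) :
  a < b ->
  (forall i, (i < r)%nat -> forall s, strip a b s -> hol_near (G i) s) ->
  (forall i, (i < r)%nat -> forall s, strip a b s -> G i s <> RtoC 0) ->
  (forall s, strip a b s -> hol_near f s) ->
  let L := fun w : C => rsum r (fun i =>
    weight a b (alpha i) (beta i) (Re w) * ln (Cmod (G i w))) in
  (forall sigma t, a <= sigma <= b -> sigma = a \/ sigma = b \/ Rabs t <= T0 ->
    Cmod (f (sigma, t)) <= exp (L (sigma, t))) ->
  (forall t, T0 < Rabs t -> forall i, (i < r)%nat -> forall x y, a <= x -> x <= y -> y <= b ->
    0 <= (alpha i - beta i) * (ln (Cmod (G i (y, t))) - ln (Cmod (G i (x, t))))) ->
  (forall w, cdiff B w) ->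
  (forall s, strip a b s -> 0 <= Re (B s)) ->
  0 < eps ->
  (forall sigma t, a <= sigma <= b -> T <= Rabs t ->
    Cmod (f (sigma, t)) <= exp (L (sigma, t) + eps * Re (B (sigma, t)))) ->
  forall sigma t, a <= sigma <= b -> Cmod (f (sigma, t)) <=
    exp (L (sigma, t) + eps * (Re (B (sigma, t)) - (sigma - a) * (sigma - b))).
Proof.
  intros hab hG hG0 hf L hbd hmono hB hB0 heps hgrow sigma0 t0 hs0.
  set (X := fun w : C => L w + eps * (Re (B w) - (Re w - a) * (Re w - b))).
  (* The exponential form stays continuous at zeros of [f]; logarithms are taken only near the
     maximum, where [f] does not vanish. *)
  set (F := fun w : C => Cmod (f w) * exp (- X w)).
  assert (F1 : forall w, F w <= 1 <-> Cmod (f w) <= exp (X w)).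
  { intro w. unfold F. rewrite exp_Ropp. assert (hp := exp_pos (X w)). split; intro h.
    - apply Rmult_le_compat_r with (r := exp (X w)) in h; [|lra].
      rewrite Rmult_assoc, Rinv_l in h by lra. lra.
    - apply Rmult_le_reg_r with (exp (X w)); [lra|].
      rewrite Rmult_assoc, Rinv_l by lra. lra. }
  change (Cmod (f (sigma0, t0)) <= exp (X (sigma0, t0))).
  apply F1. apply Rnot_lt_le; intro hbig.
  (* Both corrections in [X] are nonnegative on the strip, so the bounds by [L] persist. A point
     with F > 1 is thus off the edges and has T0 < |t| < T. *)
  assert (Fbd : forall x y, a <= x <= b -> x = a \/ x = b \/ Rabs y <= T0 \/ T <= Rabs y ->
    F (x, y) <= 1).
  { intros x y hx hc. apply F1.
    assert (q0 : (x - a) * (x - b) <= 0) by nra.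
    assert (b0 := hB0 (x, y) hx).
    destruct (Rle_dec T (Rabs y)) as [hy|hy].
    - eapply Rle_trans; [apply hgrow; assumption|]. apply exp_le_exp.
      unfold X; simpl Re. nra.
    - eapply Rle_trans; [apply hbd; tauto|].
      apply exp_le_exp.
      unfold X; simpl Re. nra. }
  assert (ht0 : Rabs t0 < T).
  { apply Rnot_le_lt; intro h. specialize (Fbd sigma0 t0 hs0 ltac:(tauto)). lra. }
  assert (contF : forall p, strip a b p -> @continuous C_UniformSpace R_UniformSpace F p).
  { intros p hp. unfold F.
    apply (continuous_mult (K := R_AbsRing) (fun w => Cmod (f w)) (fun w => exp (- X w))).
    { apply continuous_Cmod_comp, cdiff_ccont, hol_near_cdiff, hf, hp. }
    apply (continuous_comp (fun w => - X w) exp); [|apply continuous_exp].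
    apply (continuous_opp (V := R_NormedModule) X).
    assert (cRe : forall g : R -> R, (forall x, ex_derive g x) ->
      @continuous C_UniformSpace R_UniformSpace (fun w => g (Re w)) p).
    { intros g hg. apply (continuous_comp Re g).
      - apply (continuous_Re_comp (fun w => w)), ccont_id.
      - apply (ex_derive_continuous g), hg. }
    apply (continuous_plus (V := R_NormedModule) L).
    - apply continuous_rsum. intros i hi.
      apply (continuous_mult (K := R_AbsRing)
        (fun w => weight a b (alpha i) (beta i) (Re w)) (fun w => ln (Cmod (G i w)))).
      + apply cRe. intro x. unfold weight. auto_derive. lra.
      + apply (continuous_comp (fun w => Cmod (G i w)) ln).
        * apply continuous_Cmod_comp, cdiff_ccont, hol_near_cdiff, hG; assumption.
        * apply continuous_ln. apply Cmod_gt_0, hG0; assumption.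
    - apply (continuous_scal_r (V := R_NormedModule) eps).
      apply (continuous_minus (V := R_NormedModule) (fun w => Re (B w))).
      + apply continuous_Re_comp, cdiff_ccont, hB.
      + apply (cRe (fun x => (x - a) * (x - b))). intro x. auto_derive. exact I. }
  assert (hTpos : 0 < T) by (pose proof (Rabs_pos t0); lra).
  destruct (rectangle_max (fun x y => F (x, y)) a b (- T) T) as (s & t & hs & ht & hmax); try lra.
  { intros x y hx hy e he.
    assert (c := proj1 (filterlim_locally _ _) (contF (x, y) hx) (mkposreal e he)).
    destruct c as [d hd]. exists d; split; [apply cond_pos|].
    intros x' y' h1 h2. specialize (hd (x', y') (conj h1 h2)).
    change (Rabs (F (x', y') - F (x, y)) < e) in hd. apply Rabs_lt_between in hd. lra. }
  assert (Fp : 1 < F (s, t)).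
  { eapply Rlt_le_trans; [exact hbig|]. apply hmax; [exact hs0|].
    apply Rabs_lt_between in ht0; lra. }
  assert (hsa : a < s).
  { destruct (Req_dec s a) as [->|h]; [|lra]. specialize (Fbd a t ltac:(lra) ltac:(tauto)). lra. }
  assert (hsb : s < b).
  { destruct (Req_dec s b) as [->|h]; [|lra]. specialize (Fbd b t ltac:(lra) ltac:(tauto)). lra. }
  assert (htT : Rabs t < T).
  { apply Rnot_le_lt; intro h. specialize (Fbd s t hs ltac:(tauto)). lra. }
  assert (htT0 : T0 < Rabs t).
  { apply Rnot_le_lt; intro h. specialize (Fbd s t hs ltac:(tauto)). lra. }
  assert (hfp : 0 < Cmod (f (s, t))).
  { destruct (Cmod_ge_0 (f (s, t))) as [h|h]; [exact h|].
    unfold F in Fp. rewrite <- h, Rmult_0_l in Fp. lra. }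
  destruct (cdiff_ccont _ _ (hol_near_cdiff _ _ (hf (s, t) hs)) (Cmod (f (s, t))) hfp)
    as (d1 & hd1 & hfne).
  (* On this disc [f] has no zero, the points stay in the strip, and their heights stay strictly
     between [T0] and [T] in absolute value. *)
  set (delta := Rmin d1 (Rmin (Rmin (s - a) (b - s)) (Rmin (T - Rabs t) (Rabs t - T0)))).
  assert (hdelta : 0 < delta) by (unfold delta; repeat apply Rmin_pos; lra).
  assert (e1 : delta <= d1) by apply Rmin_l.
  assert (e2 := Rmin_r d1 (Rmin (Rmin (s - a) (b - s)) (Rmin (T - Rabs t) (Rabs t - T0)))).
  fold delta in e2.
  assert (e3 := Rmin_l (Rmin (s - a) (b - s)) (Rmin (T - Rabs t) (Rabs t - T0))).
  assert (e4 := Rmin_r (Rmin (s - a) (b - s)) (Rmin (T - Rabs t) (Rabs t - T0))).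
  assert (e5 := Rmin_l (s - a) (b - s)). assert (e6 := Rmin_r (s - a) (b - s)).
  assert (e7 := Rmin_l (T - Rabs t) (Rabs t - T0)).
  assert (e8 := Rmin_r (T - Rabs t) (Rabs t - T0)).
  set (l0 := fun i => weight a b (alpha i) (beta i) s).
  (* The weights are frozen at the maximum; the reflected sum of their variation has the right
     sign by monotonicity, and (eps / 2) Re (w - p)^2 makes the gain from
     (sigma - a) (sigma - b) isotropic. *)
  apply (near_harmonic_no_strict_max
    (fun w => ln (Cmod (f w)) + (-1 * rsum r (fun i => l0 i * ln (Cmod (G i w)))
       + (- eps * Re (B w) + eps / 2 * Re ((w + - (s, t)) * (w + - (s, t)))%C)))
    (s, t) eps delta).
  - apply near_harmonic_plus; [|apply near_harmonic_plus; [|apply near_harmonic_plus]].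
    + destruct (hf (s, t) hs) as (d & hd & h).
      apply (near_harmonic_ln_Cmod f (s, t) d hd h). apply Cmod_gt_0, hfp.
    + apply near_harmonic_scal, (near_harmonic_rsum r (fun i w => l0 i * ln (Cmod (G i w)))).
      intros i hi. apply near_harmonic_scal.
      destruct (hG i hi (s, t) hs) as (d & hd & h).
      apply (near_harmonic_ln_Cmod (G i) (s, t) d hd h). apply hG0; assumption.
    + apply near_harmonic_scal, near_harmonic_Re, hB.
    + apply near_harmonic_scal, (near_harmonic_Re (fun w => (w + - (s, t)) * (w + - (s, t)))%C).
      intro z. apply cdiff_mult; apply cdiff_plus; (apply cdiff_id || apply cdiff_const).
  - exact heps.
  - exact hdelta.
  - intros x y hxy.
    assert (hx := re_le_Cmod (x, y)). assert (hy := im_le_Cmod (x, y)). simpl in hx, hy.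
    assert (m2 := Cmod2_alt (x, y)). simpl Re in m2; simpl Im in m2.
    assert (mx : Cmod (- x, y) = Cmod (x, y)).
    { unfold Cmod; simpl. f_equal; ring. }
    assert (hty : T0 < Rabs (t + y) < T).
    { assert (t1 := Rabs_triang t y). assert (t2 := Rabs_triang (t + y) (- y)).
      rewrite Rabs_Ropp in t2. replace (t + y + - y) with t in t2 by ring. lra. }
    assert (hx' := Rabs_le_between x (Cmod (x, y))). apply hx' in hx. clear hx'.
    assert (near : forall x', - Cmod (x, y) <= x' <= Cmod (x, y) -> Cmod (x', y) = Cmod (x, y) ->
      ln (Cmod (f (s + x', t + y))) - X (s + x', t + y) <= ln (Cmod (f (s, t))) - X (s, t)).
    { intros x' hx' hm.
      assert (hn : 0 < Cmod (f (s + x', t + y))).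
      { specialize (hfne (s + x', t + y)).
        replace (((s + x')%R, (t + y)%R) - (s, t))%C with ((x', y) : C) in hfne
          by (apply injective_projections; simpl; ring).
        specialize (hfne ltac:(lra)).
        assert (rv := Cmod_triangle_rev (f (s + x', t + y)) (f (s, t))).
        apply Rabs_le_between in rv. lra. }
      assert (FF : F (s + x', t + y) <= F (s, t)).
      { apply (hmax (s + x') (t + y)); [lra|]. apply Rabs_le_between; lra. }
      unfold F in FF. apply ln_le in FF; [|apply Rmult_lt_0_compat; [exact hn | apply exp_pos]].
      rewrite !ln_mult, !ln_exp in FF by (assumption || apply exp_pos). lra. }
    assert (N1 := near x ltac:(lra) eq_refl). assert (N2 := near (- x) ltac:(lra) mx).
    change ((s, t) + (x, y))%C with ((s + x, t + y) : C).
    change ((s, t) + ((- x)%R, y))%C with ((s + - x, t + y) : C).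
    unfold X in N1, N2. simpl Re in N1, N2.
    assert (hsum : L (s + x, t + y) + L (s + - x, t + y) <=
      rsum r (fun i => l0 i * ln (Cmod (G i (s + x, t + y)))) +
      rsum r (fun i => l0 i * ln (Cmod (G i (s + - x, t + y))))).
    { unfold L. rewrite <- !rsum_plus. apply rsum_le. intros i hi. simpl Re.
      set (u1 := ln (Cmod (G i (s + x, t + y)))). set (u2 := ln (Cmod (G i (s + - x, t + y)))).
      assert (M : 0 <= (alpha i - beta i) * (x * (u1 - u2))).
      { destruct (Rle_dec 0 x) as [h|h].
        - assert (M := hmono (t + y) ltac:(lra) i hi (s + - x) (s + x)
            ltac:(lra) ltac:(lra) ltac:(lra)). fold u1 u2 in M. nra.
        - assert (M := hmono (t + y) ltac:(lra) i hi (s + x) (s + - x)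
            ltac:(lra) ltac:(lra) ltac:(lra)). fold u1 u2 in M. nra. }
      assert (E : weight a b (alpha i) (beta i) (s + x) * u1 +
        weight a b (alpha i) (beta i) (s + - x) * u2 =
        l0 i * u1 + l0 i * u2 - (alpha i - beta i) * (x * (u1 - u2)) / (b - a)).
      { unfold l0, weight. field. lra. }
      rewrite E. assert (0 <= (alpha i - beta i) * (x * (u1 - u2)) / (b - a))
        by (apply Rdiv_le_0_compat; lra). lra. }
    assert (hp0 : L (s, t) = rsum r (fun i => l0 i * ln (Cmod (G i (s, t))))) by reflexivity.
    rewrite hp0 in N1, N2.
    set (S1 := rsum r (fun i => l0 i * ln (Cmod (G i (s + x, t + y))))) in *.
    set (S2 := rsum r (fun i => l0 i * ln (Cmod (G i (s + - x, t + y))))) in *.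
    set (S0 := rsum r (fun i => l0 i * ln (Cmod (G i (s, t))))) in *.
    assert (sq1 : Re ((((s + x)%R, (t + y)%R) + - (s, t)) * (((s + x)%R, (t + y)%R) + - (s, t)))%C
      = x ^ 2 - y ^ 2)
      by (simpl; unfold Re; simpl; ring).
    assert (sq2 : Re ((((s + - x)%R, (t + y)%R) + - (s, t)) * (((s + - x)%R, (t + y)%R) + - (s, t)))%C
      = x ^ 2 - y ^ 2) by (simpl; unfold Re; simpl; ring).
    assert (sq0 : Re (((s, t) + - (s, t)) * ((s, t) + - (s, t)))%C = 0)
      by (simpl; unfold Re; simpl; ring).
    (* The second difference of (sigma - a) (sigma - b) contributes - 2 eps x^2 and the added square
       contributes eps (x^2 - y^2), in total - eps (x^2 + y^2). *)
    rewrite sq1, sq2, sq0, m2. lra.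
Qed.

(** * The barrier and its growth *)

(* B is cos (c (w - (a + b) / 2)). *)
Lemma strip_barrier (a b c : R) : a < b -> 0 < c -> c < PI / (b - a) ->
  exists (B : C -> C) (kappa : R), 0 < kappa /\ (forall w, cdiff B w) /\
    forall sigma t, a <= sigma <= b -> kappa * exp (c * Rabs t) <= Re (B (sigma, t)).
Proof.
  intros hab hc hcpi. set (m := (a + b) / 2).
  set (lin := fun (k : R) (w : C) => (Ci * k * (w + - RtoC m))%C).
  assert (hlin : forall k w, cdiff (fun w => cexp (lin k w)) w).
  { intros k w. apply cdiff_comp; [|apply cdiff_cexp].
    apply cdiff_mult; [apply cdiff_const|]. apply cdiff_plus; [apply cdiff_id | apply cdiff_const]. }
  exists (fun w => RtoC (/ 2) * (cexp (lin c w) + cexp (lin (- c)%R w)))%C.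
  assert (hhalf : c * ((b - a) / 2) < PI / 2).
  { apply Rmult_lt_compat_r with (r := (b - a) / 2) in hcpi; [|lra].
    replace (PI / (b - a) * ((b - a) / 2)) with (PI / 2) in hcpi by (field; lra). exact hcpi. }
  assert (hhalf0 : 0 < c * ((b - a) / 2)) by (apply Rmult_lt_0_compat; lra).
  assert (hk : 0 < cos (c * ((b - a) / 2))) by (apply cos_gt_0; lra).
  (* The real part is cos (c (sigma - m)) cosh (c t). The cosine is smallest at the edges of the
     strip, where it is positive since c (b - a) / 2 < PI / 2, and cosh (c t) >= exp (c |t|) / 2. *)
  exists (cos (c * ((b - a) / 2)) / 2). split; [lra|]. split.
  - intro w. apply cdiff_mult; [apply cdiff_const|]. apply cdiff_plus; apply hlin.
  - intros s t hs.
    assert (e : Re (RtoC (/ 2) * (cexp (lin c (s, t)) + cexp (lin (- c)%R (s, t))))%C =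
      cos (c * (s - m)) / 2 * (exp (c * t) + exp (- (c * t)))).
    { assert (l : forall k, lin k (s, t) = (- (k * t), k * (s - m))).
      { intro k. unfold lin. apply injective_projections; simpl; ring. }
      rewrite !l. unfold cexp. simpl.
      replace (- (- c * t)) with (c * t) by ring.
      replace (- c * (s - m)) with (- (c * (s - m))) by ring.
      rewrite cos_neg. unfold Re; simpl. field. }
    rewrite e.
    assert (h1 : cos (c * ((b - a) / 2)) <= cos (c * (s - m))).
    { assert (ecos : cos (c * (s - m)) = cos (c * Rabs (s - m))).
      { unfold Rabs; destruct (Rcase_abs (s - m)); [|reflexivity].
        rewrite <- cos_neg. f_equal; ring. }
      rewrite ecos. assert (hm : Rabs (s - m) <= (b - a) / 2) by (apply Rabs_le; unfold m; lra).
      assert (h0 := Rabs_pos (s - m)).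
      assert (c * Rabs (s - m) <= c * ((b - a) / 2)) by (apply Rmult_le_compat_l; lra).
      assert (0 <= c * Rabs (s - m)) by (apply Rmult_le_pos; lra).
      apply cos_decr_1; lra. }
    assert (h2 : exp (c * Rabs t) <= exp (c * t) + exp (- (c * t))).
    { assert (p1 := exp_pos (c * t)). assert (p2 := exp_pos (- (c * t))).
      unfold Rabs; destruct (Rcase_abs t); [|lra].
      replace (c * - t) with (- (c * t)) by ring. lra. }
    apply Rmult_le_compat; try lra. left; apply exp_pos.
Qed.

(** After division by exp (c3 t), the inequality exp u >= 1 + u reduces the comparison to a linear
    one in t, whose solution is the stated threshold. *)
Lemma exp_dominates (c3 c K e t : R) : 0 <= c3 -> c3 < c -> 0 <= K -> 0 < e ->
  K / (e * (c - c3)) <= t -> K * exp (c3 * t) <= e * exp (c * t).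
Proof.
  intros h3 hc hK he ht.
  replace (c * t) with (c3 * t + (c - c3) * t) by ring.
  rewrite exp_plus, (Rmult_comm (exp (c3 * t))), <- Rmult_assoc.
  apply Rmult_le_compat_r; [left; apply exp_pos|].
  assert (h1 := exp_ineq1_le ((c - c3) * t)).
  assert (h2 : K <= e * ((c - c3) * t)).
  { apply Rmult_le_compat_l with (r := e * (c - c3)) in ht; [|nra].
    replace (e * (c - c3) * (K / (e * (c - c3)))) with K in ht by (field; lra). lra. }
  nra.
Qed.

(** * Low heights, product form of the bound, and conclusion *)

Lemma min_on_attained (a b : R) (g : R -> R) : a <= b ->
  (forall x, a <= x <= b -> continuity_pt g x) -> is_min_on a b g (min_on a b g).
Proof.
  intros hab hg. unfold min_on. apply epsilon_spec.
  destruct (continuity_ab_min g a b hab hg) as (x & h1 & h2).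
  exists (g x); split; [exists x; split; [exact h2 | reflexivity] | exact h1].
Qed.

Lemma continuity_pt_Cmod_slice (g : C -> C) (x t : R) : ccont g (x, t) ->
  continuity_pt (fun s => Cmod (g (s, t))) x.
Proof.
  intro h. apply continuity_pt_filterlim, continuous_of_Rabs. intros eps he.
  destruct (h eps he) as (d & hd & k). exists d; split; [exact hd|]. intros s hs.
  eapply Rle_lt_trans; [apply Cmod_triangle_rev | apply k].
  replace ((s, t) - (x, t))%C with (RtoC (s - x)) by (apply injective_projections; simpl; ring).
  rewrite Cmod_R; exact hs.
Qed.

(** [Rpower] is the exponential of a multiple of [ln], so both sides are exponentials and only the
    exponents have to be compared. *)
Lemma Rpower_Rprod_weights (r : nat) (u alpha beta : nat -> R) (a b sigma : R) :
  Rpower (Rprod r (fun i => Rpower (u i) (alpha i))) ((b - sigma) / (b - a)) *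
  Rpower (Rprod r (fun i => Rpower (u i) (beta i))) ((sigma - a) / (b - a)) =
  exp (rsum r (fun i => weight a b (alpha i) (beta i) sigma * ln (u i))).
Proof.
  unfold Rpower. rewrite !Rprod_exp, !ln_exp, <- exp_plus, <- !rsum_scal, <- rsum_plus.
  f_equal. apply rsum_ext. intros i _. unfold weight. ring.
Qed.

(* Rpower x y is the real power x^y = exp (y ln x) for x > 0; every base below
   is positive because of the lower bound on the |G_i|. *)
Theorem theorem2p1 (a b : R) (hab : a < b)
  (r : nat) (G : nat -> C -> C) (f : C -> C)
  (C1 C2 C3 : R) (hC1 : 0 < C1) (hC2 : 0 < C2)
  (hC3pos : 0 < C3) (hC3 : C3 < PI / (b - a))
  (hG : forall i : nat, (i < r)%nat -> holomorphic_on (strip a b) (G i))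
  (hGconj : forall i : nat, (i < r)%nat ->
    forall s : C, strip a b s -> Cconj (G i s) = G i (Cconj s))
  (hGlow : forall i : nat, (i < r)%nat ->
    forall sigma t : R, a <= sigma <= b ->
      C1 * exp (- C2 * exp (C3 * Rabs t)) < Cmod (G i (sigma, t)))
  (hf : holomorphic_on (strip a b) f)
  (hfup : forall sigma t : R, a <= sigma <= b ->
      Cmod (f (sigma, t)) < C1 * exp (C2 * exp (C3 * Rabs t)))
  (alpha beta : nat -> R)
  (halpha : forall i : nat, (i < r)%nat -> 0 <= alpha i)
  (hbeta : forall i : nat, (i < r)%nat -> 0 <= beta i)
  (hfa : forall t : R,
      Cmod (f (a, t)) <= Rprod r (fun i => Rpower (Cmod (G i (a, t))) (alpha i)))
  (hfb : forall t : R,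
      Cmod (f (b, t)) <= Rprod r (fun i => Rpower (Cmod (G i (b, t))) (beta i)))
  (T0 : R) (hT0 : 0 <= T0)
  (hinc : forall t : R, T0 < Rabs t -> forall i : nat, (i < r)%nat ->
      beta i < alpha i ->
      increasing_on a b (fun sigma => Cmod (G i (sigma, t))))
  (hdec : forall t : R, T0 < Rabs t -> forall i : nat, (i < r)%nat ->
      alpha i < beta i ->
      decreasing_on a b (fun sigma => Cmod (G i (sigma, t))))
  (hmin : forall t : R, Rabs t <= T0 -> forall sigma : R, a <= sigma <= b ->
      Cmod (f (sigma, t)) <
      Rprod r (fun i =>
        Rpower (min_on a b (fun sigma' => Cmod (G i (sigma', t))))
          (alpha i * ((b - sigma) / (b - a)) + beta i * ((sigma - a) / (b - a))))) :
  forall sigma t : R, a <= sigma <= b ->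
    Cmod (f (sigma, t)) <=
    Rpower (Rprod r (fun i => Rpower (Cmod (G i (sigma, t))) (alpha i)))
      ((b - sigma) / (b - a)) *
    Rpower (Rprod r (fun i => Rpower (Cmod (G i (sigma, t))) (beta i)))
      ((sigma - a) / (b - a)).
Proof.
  assert (hGh : forall i, (i < r)%nat -> forall s, strip a b s -> hol_near (G i) s).
  { intros i hi s hs. apply (holomorphic_on_hol_near (strip a b)); [apply hG, hi | exact hs]. }
  assert (hGpos : forall i, (i < r)%nat -> forall s, strip a b s -> 0 < Cmod (G i s)).
  { intros i hi [x y] hs. eapply Rlt_trans; [|apply (hGlow i hi x y hs)].
    apply Rmult_lt_0_compat; [exact hC1 | apply exp_pos]. }
  set (L := fun w : C => rsum r (fun i =>
    weight a b (alpha i) (beta i) (Re w) * ln (Cmod (G i w)))).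
  assert (hbd : forall sigma t, a <= sigma <= b -> sigma = a \/ sigma = b \/ Rabs t <= T0 ->
    Cmod (f (sigma, t)) <= exp (L (sigma, t))).
  { intros s t hs [->|[->|ht]].
    - eapply Rle_trans; [apply hfa|]. unfold Rpower; rewrite Rprod_exp. right; f_equal.
      apply rsum_ext; intros i _. unfold weight; simpl Re. field; lra.
    - eapply Rle_trans; [apply hfb|]. unfold Rpower; rewrite Rprod_exp. right; f_equal.
      apply rsum_ext; intros i _. unfold weight; simpl Re. field; lra.
    (* The weights are nonnegative, so each positive minimum may be replaced by the larger value
       |G_i| at the point itself. *)
    - eapply Rle_trans; [left; apply (hmin t ht s hs)|].
      unfold Rpower; rewrite Rprod_exp. apply exp_le_exp, rsum_le. intros i hi.
      fold (weight a b (alpha i) (beta i) s). simpl Re.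
      apply Rmult_le_compat_l.
      { apply (weight_bounds a b); auto. }
      destruct (min_on_attained a b (fun s => Cmod (G i (s, t))) ltac:(lra)) as [[x [hx e]] hle].
      { intros x hx. apply continuity_pt_Cmod_slice, cdiff_ccont, hol_near_cdiff, hGh; assumption. }
      apply ln_le; [|apply hle, hs]. rewrite <- e. apply hGpos; assumption. }
  assert (hmono : forall t, T0 < Rabs t -> forall i, (i < r)%nat ->
    forall x y, a <= x -> x <= y -> y <= b ->
    0 <= (alpha i - beta i) * (ln (Cmod (G i (y, t))) - ln (Cmod (G i (x, t))))).
  { intros t ht i hi x y hx hxy hy.
    assert (px := hGpos i hi (x, t) ltac:(unfold strip; simpl; lra)).
    assert (py := hGpos i hi (y, t) ltac:(unfold strip; simpl; lra)).
    destruct (Rtotal_order (alpha i) (beta i)) as [h|[h|h]].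
    - assert (M := ln_le _ _ py (hdec t ht i hi h x y hx hxy hy)). nra.
    - rewrite h. lra.
    - assert (M := ln_le _ _ px (hinc t ht i hi h x y hx hxy hy)). nra. }
  (* The midpoint lies strictly above [C3], for domination, and strictly below PI / (b - a), for
     positivity of the barrier. *)
  set (c := (C3 + PI / (b - a)) / 2).
  destruct (strip_barrier a b c hab ltac:(unfold c; lra) ltac:(unfold c; lra))
    as (B & kappa & hkappa & hB & hBlow).
  assert (hB0 : forall s, strip a b s -> 0 <= Re (B s)).
  { intros [x y] hs. eapply Rle_trans; [|apply hBlow, hs].
    apply Rmult_le_pos; [lra | left; apply exp_pos]. }
  set (S := rsum r (fun i => alpha i + beta i)).
  assert (hS : 0 <= S).
  { replace 0 with (rsum r (fun _ => 0)).
    - apply rsum_le. intros i hi. specialize (halpha i hi). specialize (hbeta i hi). lra.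
    - clear; induction r as [|r IH]; simpl; lra. }
  set (l1 := Rabs (ln C1)). assert (hl1 : 0 <= l1) by apply Rabs_pos.
  assert (hl1' : - l1 <= ln C1 <= l1) by (apply Rabs_le_between; unfold l1; lra).
  (* With E = exp (C3 |t|) >= 1, the bounds give ln |f| <= l1 + C2 E wherever f is nonzero, and ln
     |G_i| >= - (l1 + C2 E). The weights add up to at most [S], so - L <= S (l1 + C2 E). *)
  set (K := (1 + S) * (l1 + C2)). assert (hK : 0 <= K) by (unfold K; apply Rmult_le_pos; lra).
  assert (hgrow : forall s t, a <= s <= b ->
    Cmod (f (s, t)) <= exp (L (s, t) + K * exp (C3 * Rabs t))).
  { intros s t hs. set (E := exp (C3 * Rabs t)).
    assert (hE : 1 <= E).
    { unfold E. assert (h := exp_ineq1_le (C3 * Rabs t)).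
      assert (0 <= C3 * Rabs t) by (apply Rmult_le_pos; [lra | apply Rabs_pos]). lra. }
    assert (hL : - ((l1 + C2 * E) * S) <= L (s, t)).
    { unfold S, L. rewrite <- rsum_scal.
      replace (- rsum r (fun i => (l1 + C2 * E) * (alpha i + beta i))) with
        (rsum r (fun i => -1 * ((l1 + C2 * E) * (alpha i + beta i))))
        by (rewrite rsum_scal; ring).
      apply rsum_le. intros i hi. simpl Re.
      destruct (weight_bounds a b (alpha i) (beta i) s hab (halpha i hi) (hbeta i hi) hs)
        as [w1 w2].
      assert (g : - (l1 + C2 * E) <= ln (Cmod (G i (s, t)))).
      { assert (g := hGlow i hi s t hs). apply Rlt_le, ln_le in g;
          [|apply Rmult_lt_0_compat; [exact hC1 | apply exp_pos]].
        rewrite ln_mult, ln_exp in g by (assumption || apply exp_pos).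
        fold E in g. lra. }
      set (w := weight a b (alpha i) (beta i) s) in *.
      assert (0 <= l1 + C2 * E) by nra.
      apply Rle_trans with (w * - (l1 + C2 * E)); [nra|].
      apply Rmult_le_compat_l; assumption. }
    left. eapply Rlt_le_trans; [apply hfup, hs|].
    rewrite <- (exp_ln C1) at 1 by exact hC1. rewrite <- exp_plus. apply exp_le_exp.
    fold E. unfold K.
    assert (l1 * S <= l1 * S * E) by (assert (0 <= l1 * S) by (apply Rmult_le_pos; lra); nra).
    assert (l1 <= l1 * E) by nra. nra. }
  intros s t hs.
  rewrite (Rpower_Rprod_weights r (fun i => Cmod (G i (s, t))) alpha beta a b s).
  change (Cmod (f (s, t)) <= exp (L (s, t))).
  apply Rnot_lt_le; intro hlt.
  assert (hfpos : 0 < Cmod (f (s, t))) by (eapply Rlt_trans; [apply exp_pos | exact hlt]).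
  assert (hlnlt : L (s, t) < ln (Cmod (f (s, t)))).
  { rewrite <- (ln_exp (L (s, t))). apply ln_increasing; [apply exp_pos | exact hlt]. }
  set (X := Re (B (s, t)) - (s - a) * (s - b)).
  assert (hX : 0 <= X) by (assert (h := hB0 (s, t) hs); unfold X; nra).
  (* This replaces the limit eps -> 0: eps X is less than the assumed gap. The added 1 covers X =
     0. *)
  set (eps := (ln (Cmod (f (s, t))) - L (s, t)) / (2 * (X + 1))).
  assert (heps : 0 < eps) by (apply Rdiv_lt_0_compat; lra).
  assert (main : Cmod (f (s, t)) <= exp (L (s, t) + eps * X)).
  (* The height [T] is the threshold of [exp_dominates] with e = eps kappa: beyond it the barrier
     absorbs K exp (C3 |t|). *)
  { apply (strip_max_principle a b r G f alpha beta T0 B eps (K / (eps * kappa * (c - C3))));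
      try assumption.
    - intros i hi z hz. apply Cmod_gt_0, hGpos; assumption.
    - intros z hz. apply (holomorphic_on_hol_near (strip a b)); assumption.
    - intros x y hx hy. eapply Rle_trans; [apply hgrow, hx|]. apply exp_le_exp.
      apply Rplus_le_compat_l.
      apply Rle_trans with (eps * kappa * exp (c * Rabs y)).
      + apply exp_dominates; try lra; [unfold c; lra | apply Rmult_lt_0_compat; assumption].
      + rewrite Rmult_assoc. apply Rmult_le_compat_l; [lra | apply hBlow, hx]. }
  apply ln_le in main; [|exact hfpos]. rewrite ln_exp in main.
  assert (he : eps * (2 * (X + 1)) = ln (Cmod (f (s, t))) - L (s, t)) by (unfold eps; field; lra).
  nra.
Qed.
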